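(* Let $F_{ab}$ be a (smooth) Maxwell field on the Schwarzschild exterior, i.e. a real $2$-form with $\nabla^aF_{ab}=0$ and $\nabla_{[a}F_{bc]}=0$, and let $\beta_a$, $\mathbf{H}_{ab}$, $U_a$, $\xi^a$ be as defined in the context. Then $$\nabla^{b}\mathbf{H}_{ab}=-U_{a}\,\beta^{b}\bar\beta_{b},\qquad \xi^{a}\nabla^{b}\mathbf{H}_{ab}=0.$$ In particular, $\xi^b\mathbf{H}_{ab}$ is a positive conserved current: $\nabla^a(\mathbf{H}_{ab}\xi^b)=0$, and $\mathbf{H}_{ab}\xi^bN^a\ge 0$ for every future-directed timelike vector $N^a$.
   Context: The Schwarzschild exterior ($M>0$) is $\{(t,r,\theta,\phi)\in \mathbb{R}\times(2M,\infty)\times[0,\pi]\times[0,2\pi)\}$ with metric $$g_{ab}dx^adx^b=(1-2M/r)dt^2-(1-2M/r)^{-1}dr^2-r^2(d\theta^2+\sin^2\theta\, d\phi^2)$$ (signature $+---$; timelike means $v^av_a>0$), time-oriented by $\partial_t$. All fields are assumed smooth. $\xi^a=(\partial_t)^a$. Let $*$ denote the Hodge dual on $2$-forms, ${*}F_{ab}=\tfrac12\epsilon_{abcd}F^{cd}$ (the tensor $\mathbf{H}_{ab}$ below does not depend on the choice of orientation). Square and round brackets on indices denote (normalized) antisymmetrization and symmetrization. Put $$Y_{ab}=-2r^3\sin\theta\, d\theta_{[a}d\phi_{b]},\qquad U_a=-r^{-1}\nabla_a r,\qquad Z_{ab}=-\tfrac43\,{*}F_{[a}{}^{c}Y_{b]c},$$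 $$\beta_a=-\tfrac12U^bZ_{ab}-\tfrac12 i\,U^b\,{*}Z_{ab}-\tfrac12\nabla_bZ_a{}^b-\tfrac12 i\,\nabla_b{*}Z_a{}^b,$$ $$\mathbf{H}_{ab}=\beta_{(a}\bar\beta_{b)}-\tfrac12g_{ab}\beta^c\bar\beta_c .$$ (In $2$-spinor form, $\mathbf{H}_{ABA'B'}=\tfrac12\beta_{AB'}\bar\beta_{A'B}+\tfrac12\beta_{BA'}\bar\beta_{B'A}$.) *)

(* Defs.v *)
From Stdlib Require Import Reals Lra Lia ZArith List.
From Coquelicot Require Import Coquelicot.
Import ListNotations.
Open Scope R_scope.

Inductive idx := i0 | i1 | i2 | i3.

Definition R4 : Type := (R * R * R * R)%type.

Definition coord (i : idx) (p : R4) : R :=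
  match p with (x0, x1, x2, x3) =>
    match i with i0 => x0 | i1 => x1 | i2 => x2 | i3 => x3 end
  end.

Definition upd (i : idx) (x : R) (p : R4) : R4 :=
  match p with (x0, x1, x2, x3) =>
    match i with
    | i0 => (x, x1, x2, x3) | i1 => (x0, x, x2, x3)
    | i2 => (x0, x1, x, x3) | i3 => (x0, x1, x2, x)
    end
  end.

Definition sum4 (f : idx -> R) : R := f i0 + f i1 + f i2 + f i3.
Definition sum4C (f : idx -> C) : C := (f i0 + f i1 + f i2 + f i3)%C.

Definition pd (i : idx) (f : R4 -> R) (p : R4) : R :=
  Derive (fun x => f (upd i x p)) (coord i p).

Fixpoint pds (l : list idx) (f : R4 -> R) : R4 -> R :=
  match l with
  | [] => f
  | i :: l' => pd i (pds l' f)
  end.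

(* C^infinity on the open set [D]: all iterated partial derivatives exist and
   are continuous at the points of [D].  [Derive] is total, so existence is
   required separately. *)
Definition smooth_on (D : R4 -> Prop) (f : R4 -> R) : Prop :=
  forall (l : list idx) (p : R4), D p ->
    continuous (pds l f) p /\
    forall i, ex_derive (fun x => pds l f (upd i x p)) (coord i p).

(* The exterior is R x {x in R^3 : |x| > 2M}, with points (t,x,y,z). *)
Definition exterior (M : R) (q : R4) : Prop :=
  match q with (_, x, y, z) => 2 * M < sqrt (x ^ 2 + y ^ 2 + z ^ 2) end.

(* Spherical coordinates (t,r,theta,phi) degenerate where sin theta = 0.  Two
   spherical charts, with polar axis z and polar axis x, together cover the
   exterior (lemma [chart_cover]).  They differ by a rotation of R^3, so the
   metric, r, d/dt, the 2-form Y below and the orientation have the same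
   coordinate expressions in both (lemmas [chart_metric], [chart_Y]).  The
   angle phi ranges over R; coordinate components are then periodic in phi. *)
Inductive axis := axis_z | axis_x.

Definition chart (k : axis) (p : R4) : R4 :=
  match p with (t, r, th, ph) =>
    match k with
    | axis_z => (t, r * sin th * cos ph, r * sin th * sin ph, r * cos th)
    | axis_x => (t, r * cos th, r * sin th * cos ph, r * sin th * sin ph)
    end
  end.

Definition chart_dom (M : R) (p : R4) : Prop :=
  match p with (_, r, th, _) => 2 * M < r /\ 0 < th < PI end.

Definition tensor1 := R4 -> idx -> R.
Definition tensor2 := R4 -> idx -> idx -> R.
Definition ctensor1 := R4 -> idx -> C.
Definition ctensor2 := R4 -> idx -> idx -> C.

Definition jac (k : axis) (p : R4) (i a : idx) : R :=
  pd a (fun q => coord i (chart k q)) p.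

(* Components in the chart [k] of a covariant 2-tensor given by its components
   in the global coordinates (t,x,y,z). *)
Definition pullback (k : axis) (T : tensor2) : tensor2 := fun p a b =>
  sum4 (fun i => sum4 (fun j => jac k p i a * jac k p j b * T (chart k p) i j)).

(* A tensor field is smooth when its components in every chart of the atlas
   are. *)
Definition smooth_tensor2 (M : R) (T : tensor2) : Prop :=
  forall k a b, smooth_on (chart_dom M) (fun p => pullback k T p a b).

Definition metric (M : R) : tensor2 := fun p a b =>
  match p with (_, r, th, _) =>
    match a, b with
    | i0, i0 => 1 - 2 * M / r
    | i1, i1 => - / (1 - 2 * M / r)
    | i2, i2 => - r ^ 2
    | i3, i3 => - (r ^ 2 * sin th ^ 2)
    | _, _ => 0
    end
  end.

Definition inv_metric (M : R) : tensor2 := fun p a b =>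
  match p with (_, r, th, _) =>
    match a, b with
    | i0, i0 => / (1 - 2 * M / r)
    | i1, i1 => - (1 - 2 * M / r)
    | i2, i2 => - / r ^ 2
    | i3, i3 => - / (r ^ 2 * sin th ^ 2)
    | _, _ => 0
    end
  end.

(* [christoffel M p c a b] is Gamma^c_{ab}. *)
Definition christoffel (M : R) (p : R4) (c a b : idx) : R :=
  / 2 * sum4 (fun d => inv_metric M p c d *
    (pd a (fun q => metric M q b d) p + pd b (fun q => metric M q a d) p
     - pd d (fun q => metric M q a b) p)).

(* [nabla1 M V p a b] is nabla_a V_b and [nabla2 M T p a b c] is
   nabla_a T_{bc}: the derivative index comes first. *)
Definition nabla1 (M : R) (V : tensor1) (p : R4) (a b : idx) : R :=
  pd a (fun q => V q b) p - sum4 (fun d => christoffel M p d a b * V p d).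

Definition nabla2 (M : R) (T : tensor2) (p : R4) (a b c : idx) : R :=
  pd a (fun q => T q b c) p
  - sum4 (fun d => christoffel M p d a b * T p d c)
  - sum4 (fun d => christoffel M p d a c * T p b d).

(* The C-linear extensions to complex tensor fields. *)
Definition nabla1C (M : R) (V : ctensor1) (p : R4) (a b : idx) : C :=
  (nabla1 M (fun q e => Re (V q e)) p a b,
   nabla1 M (fun q e => Im (V q e)) p a b).

Definition nabla2C (M : R) (T : ctensor2) (p : R4) (a b c : idx) : C :=
  (nabla2 M (fun q e f => Re (T q e f)) p a b c,
   nabla2 M (fun q e f => Im (T q e f)) p a b c).

(* nabla^b T_{ab}, contracting the second index of T. *)
Definition div2 (M : R) (T : tensor2) : tensor1 := fun p a =>
  sum4 (fun b => sum4 (fun c => inv_metric M p b c * nabla2 M T p c a b)).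

Definition div2C (M : R) (T : ctensor2) : ctensor1 := fun p a =>
  sum4C (fun b => sum4C (fun c =>
    RtoC (inv_metric M p b c) * nabla2C M T p c a b))%C.

(* nabla^a V_a *)
Definition div1C (M : R) (V : ctensor1) (p : R4) : C :=
  sum4C (fun a => sum4C (fun b =>
    RtoC (inv_metric M p a b) * nabla1C M V p b a))%C.

Definition idxZ (a : idx) : Z :=
  match a with i0 => 0 | i1 => 1 | i2 => 2 | i3 => 3 end%Z.

Definition levi_civita (a b c d : idx) : R :=
  let a := idxZ a in let b := idxZ b in let c := idxZ c in let d := idxZ d in
  IZR (Z.sgn ((b - a) * (c - a) * (d - a) * (c - b) * (d - b) * (d - c))).

(* The volume form of either orientation; r^2 sin theta is sqrt |det g|. *)
Inductive orientation := orient_pos | orient_neg.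

Definition orient_sign (o : orientation) : R :=
  match o with orient_pos => 1 | orient_neg => -1 end.

Definition vol (o : orientation) (p : R4) (a b c d : idx) : R :=
  match p with (_, r, th, _) =>
    orient_sign o * (r ^ 2 * sin th) * levi_civita a b c d
  end.

Definition raise2 (M : R) (T : tensor2) : tensor2 := fun p a b =>
  sum4 (fun c => sum4 (fun d =>
    inv_metric M p a c * inv_metric M p b d * T p c d)).

Definition raise1 (M : R) (V : tensor1) : tensor1 := fun p a =>
  sum4 (fun b => inv_metric M p a b * V p b).

Definition star (M : R) (o : orientation) (T : tensor2) : tensor2 :=
  fun p a b =>
  / 2 * sum4 (fun c => sum4 (fun d => vol o p a b c d * raise2 M T p c d)).

Definition asym2 (T : idx -> idx -> R) (a b : idx) : R :=
  / 2 * (T a b - T b a).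

Definition asym3 (T : idx -> idx -> idx -> R) (a b c : idx) : R :=
  / 6 * (T a b c + T b c a + T c a b - T b a c - T a c b - T c b a).

Definition maxwell_chart (M : R) (F : tensor2) : Prop :=
  forall p, chart_dom M p ->
    (forall b, sum4 (fun a => sum4 (fun c =>
       inv_metric M p a c * nabla2 M F p c a b)) = 0) /\
    (forall a b c, asym3 (nabla2 M F p) a b c = 0).

Definition two_form (M : R) (F : tensor2) : Prop :=
  forall q, exterior M q -> forall i j, F q i j = - F q j i.

(* [F] is given by its components in the global coordinates (t,x,y,z). *)
Definition maxwell_field (M : R) (F : tensor2) : Prop :=
  two_form M F /\ smooth_tensor2 M F /\
  forall k, maxwell_chart M (pullback k F).

(* The differential d x^i. *)
Definition dcoord (i a : idx) (p : R4) : R := pd a (coord i) p.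

Definition xi (a : idx) : R := match a with i0 => 1 | _ => 0 end.

Definition Y : tensor2 := fun p a b =>
  match p with (_, r, th, _) =>
    -2 * r ^ 3 * sin th *
    asym2 (fun c d => dcoord i2 c p * dcoord i3 d p) a b
  end.

Definition U : tensor1 := fun p a => - / coord i1 p * dcoord i1 a p.

(* [asym2] acts on X_{ab} = *F_a^c Y_{bc}. *)
Definition Zten (M : R) (o : orientation) (F : tensor2) : tensor2 :=
  fun p a b =>
  - (4 / 3) * asym2 (fun e f => sum4 (fun c => sum4 (fun d =>
    inv_metric M p c d * star M o F p e d * Y p f c))) a b.

Definition beta (M : R) (o : orientation) (F : tensor2) : ctensor1 :=
  fun p a =>
  let Z := Zten M o F in
  let sZ := star M o Z in
  let Uup := raise1 M U p in
  (- (/ 2) * RtoC (sum4 (fun b => Uup b * Z p a b)%R)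
   - / 2 * Ci * RtoC (sum4 (fun b => Uup b * sZ p a b)%R)
   - / 2 * RtoC (div2 M Z p a)
   - / 2 * Ci * RtoC (div2 M sZ p a))%C.

(* beta^c conj(beta)_c *)
Definition beta_norm (M : R) (o : orientation) (F : tensor2) (p : R4) : C :=
  sum4C (fun c => sum4C (fun d =>
    RtoC (inv_metric M p c d) * beta M o F p d * Cconj (beta M o F p c)))%C.

Definition Hten (M : R) (o : orientation) (F : tensor2) : ctensor2 :=
  fun p a b =>
  let be := beta M o F p in
  (/ 2 * (be a * Cconj (be b) + be b * Cconj (be a))
   - / 2 * RtoC (metric M p a b) * beta_norm M o F p)%C.

Definition current (M : R) (o : orientation) (F : tensor2) : ctensor1 :=
  fun p a => sum4C (fun b => Hten M o F p a b * RtoC (xi b))%C.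

Definition ip (M : R) (p : R4) (v w : idx -> R) : R :=
  sum4 (fun a => sum4 (fun b => metric M p a b * v a * w b)).

Definition timelike (M : R) (p : R4) (v : idx -> R) : Prop := 0 < ip M p v v.

(* In signature (+,-,-,-) a timelike vector lies in the same half of the light
   cone as the timelike vector d/dt iff their inner product is positive. *)
Definition future_timelike (M : R) (p : R4) (v : idx -> R) : Prop :=
  timelike M p v /\ 0 < ip M p xi v.

Lemma inv_metricE (M : R) (p : R4) (a c : idx) : 0 < M -> chart_dom M p ->
  sum4 (fun b => metric M p a b * inv_metric M p b c) =
  match a, c with i0, i0 | i1, i1 | i2, i2 | i3, i3 => 1 | _, _ => 0 end.
Proof.
intros HM; destruct p as [[[t r] th] ph]; intros [Hr Hth].
assert (Hs := sin_gt_0 th (proj1 Hth) (proj2 Hth)).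
destruct a, c; unfold sum4; simpl; field; repeat split; lra.
Qed.

Lemma polar (x y : R) : 0 < x ^ 2 + y ^ 2 ->
  exists ph, x = sqrt (x ^ 2 + y ^ 2) * cos ph /\
             y = sqrt (x ^ 2 + y ^ 2) * sin ph.
Proof.
intros H; set (s := sqrt (x ^ 2 + y ^ 2)).
assert (Hs : 0 < s) by (apply sqrt_lt_R0; exact H).
assert (Hs2 : s * s = x ^ 2 + y ^ 2) by (apply sqrt_sqrt; lra).
assert (Hb : -1 <= x / s <= 1).
{ assert (Hu : (x / s) * (x / s) <= 1).
  { apply (Rmult_le_reg_r (s * s)); [nra|].
    replace (x / s * (x / s) * (s * s)) with (x ^ 2) by (field; lra).
    assert (Hy2 := pow2_ge_0 y); lra. }
  split; nra. }
assert (Hy : s * sqrt (1 - (x / s)²) = Rabs y).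
{ rewrite <- (sqrt_Rsqr_abs y), <- (sqrt_square s) at 1 by lra.
  rewrite <- sqrt_mult_alt by nra; f_equal; unfold Rsqr.
  replace (s * s * (1 - x / s * (x / s))) with (s * s - x ^ 2)
    by (field; lra).
  rewrite Hs2; ring. }
destruct (Rle_dec 0 y) as [Hp | Hn].
- exists (acos (x / s)); rewrite cos_acos, sin_acos by exact Hb.
  split; [field; lra|]; rewrite Hy, Rabs_pos_eq; auto.
- exists (- acos (x / s)); rewrite cos_neg, sin_neg, cos_acos, sin_acos
    by exact Hb.
  split; [field; lra|].
  rewrite <- Ropp_mult_distr_r, Hy, Rabs_left; lra.
Qed.

Lemma spherical (x y z : R) : 0 < x ^ 2 + y ^ 2 ->
  let r := sqrt (x ^ 2 + y ^ 2 + z ^ 2) in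
  exists th ph, 0 < th < PI /\ x = r * sin th * cos ph /\
    y = r * sin th * sin ph /\ z = r * cos th.
Proof.
intros H r.
destruct (polar x y H) as [ph [Hx Hy]].
assert (Hr : 0 < r) by (apply sqrt_lt_R0; nra).
assert (Hr2 : r * r = x ^ 2 + y ^ 2 + z ^ 2) by (apply sqrt_sqrt; nra).
assert (Hb : -1 < z / r < 1).
{ assert (Hu : z / r * (z / r) < 1).
  { apply (Rmult_lt_reg_r (r * r)); [nra|].
    replace (z / r * (z / r) * (r * r)) with (z ^ 2) by (field; lra); lra. }
  split; nra. }
exists (acos (z / r)), ph.
assert (Hc := cos_acos (z / r) ltac:(lra)).
assert (Hsn := sin_acos (z / r) ltac:(lra)).
assert (Hrs : r * sqrt (1 - (z / r)²) = sqrt (x ^ 2 + y ^ 2)).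
{ rewrite <- (sqrt_square r) at 1 by lra.
  rewrite <- sqrt_mult_alt by nra; f_equal; unfold Rsqr.
  replace (r * r * (1 - z / r * (z / r))) with (r * r - z ^ 2)
    by (field; lra).
  rewrite Hr2; ring. }
split; [apply acos_bound_lt; exact Hb|].
rewrite Hc, Hsn, Hrs; repeat split; auto; field; lra.
Qed.

Lemma chart_cover (M : R) (q : R4) : 0 < M ->
  exterior M q <-> exists k p, chart_dom M p /\ chart k p = q.
Proof.
intros HM; destruct q as [[[t x] y] z]; split.
- intros Hq; change (2 * M < sqrt (x ^ 2 + y ^ 2 + z ^ 2)) in Hq.
  destruct (Rlt_dec 0 (x ^ 2 + y ^ 2)) as [H | H].
  + destruct (spherical x y z H) as (th & ph & Hth & Hx & Hy & Hz).
    exists axis_z, (t, sqrt (x ^ 2 + y ^ 2 + z ^ 2), th, ph).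
    split; [split; assumption|]; simpl in *; congruence.
  + assert (H' : 0 < y ^ 2 + z ^ 2).
    { assert (Hs := sqrt_lt_R0 (x ^ 2 + y ^ 2 + z ^ 2)).
      destruct (Rlt_dec 0 (y ^ 2 + z ^ 2)) as [?|Hn]; [assumption|].
      exfalso; replace (x ^ 2 + y ^ 2 + z ^ 2) with 0 in Hq by nra.
      rewrite sqrt_0 in Hq; lra. }
    destruct (spherical y z x H') as (th & ph & Hth & Hy & Hz & Hx).
    replace (y ^ 2 + z ^ 2 + x ^ 2) with (x ^ 2 + y ^ 2 + z ^ 2) in * by ring.
    exists axis_x, (t, sqrt (x ^ 2 + y ^ 2 + z ^ 2), th, ph).
    split; [split; assumption|]; simpl in *; congruence.
- intros (k & [[[t' r] th] ph] & [Hr Hth] & Hq).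
  assert (E : x ^ 2 + y ^ 2 + z ^ 2 = r * r).
  { assert (H1 := sin2_cos2 th); assert (H2 := sin2_cos2 ph).
    unfold Rsqr in H1, H2.
    destruct k; injection Hq; intros <- <- <- _.
    - transitivity (r * r * (sin th * sin th *
        (sin ph * sin ph + cos ph * cos ph) + cos th * cos th)); [ring|].
      rewrite H2, Rmult_1_r, H1; ring.
    - transitivity (r * r * (sin th * sin th *
        (sin ph * sin ph + cos ph * cos ph) + cos th * cos th)); [ring|].
      rewrite H2, Rmult_1_r, H1; ring. }
  unfold exterior; rewrite E, sqrt_square by lra; exact Hr.
Qed.

Lemma jacE (k : axis) (t r th ph : R) (i a : idx) :
  jac k (t, r, th, ph) i a =
  match k, i, a with
  | _, i0, i0 => 1
  | axis_z, i1, i1 | axis_x, i2, i1 => sin th * cos ph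
  | axis_z, i1, i2 | axis_x, i2, i2 => r * cos th * cos ph
  | axis_z, i1, i3 | axis_x, i2, i3 => - (r * sin th * sin ph)
  | axis_z, i2, i1 | axis_x, i3, i1 => sin th * sin ph
  | axis_z, i2, i2 | axis_x, i3, i2 => r * cos th * sin ph
  | axis_z, i2, i3 | axis_x, i3, i3 => r * sin th * cos ph
  | axis_z, i3, i1 | axis_x, i1, i1 => cos th
  | axis_z, i3, i2 | axis_x, i1, i2 => - (r * sin th)
  | _, _, _ => 0
  end.
Proof.
unfold jac, pd; destruct k, i, a; simpl;
  apply is_derive_unique; auto_derive; auto; ring.
Qed.

(* The metric in the global coordinates (t,x,y,z), where |x| = r:
   f dt^2 - (dx^2 + dy^2 + dz^2) - (1/f - 1) dr^2 with f = 1 - 2M/r. *)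
Definition global_metric (M : R) : tensor2 := fun q i j =>
  match q with (_, x, y, z) =>
    let r := sqrt (x ^ 2 + y ^ 2 + z ^ 2) in
    let f := 1 - 2 * M / r in
    match i, j with
    | i0, i0 => f
    | i0, _ | _, i0 => 0
    | _, _ => - match i, j with i1, i1 | i2, i2 | i3, i3 => 1 | _, _ => 0 end
              - (/ f - 1) * (coord i q / r) * (coord j q / r)
    end
  end.

(* Y = - (x dy /\ dz + y dz /\ dx + z dx /\ dy). *)
Definition global_Y : tensor2 := fun q i j =>
  match q with (_, x, y, z) =>
    match i, j with
    | i1, i2 => - z | i2, i1 => z
    | i2, i3 => - x | i3, i2 => x
    | i3, i1 => - y | i1, i3 => y
    | _, _ => 0
    end
  end.

Lemma chart_radius (r th ph : R) : 0 < r ->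
  sqrt ((r * sin th * cos ph) ^ 2 + (r * sin th * sin ph) ^ 2
        + (r * cos th) ^ 2) = r /\
  sqrt ((r * cos th) ^ 2 + (r * sin th * cos ph) ^ 2
        + (r * sin th * sin ph) ^ 2) = r.
Proof.
intros Hr; assert (H1 := sin2_cos2 th); assert (H2 := sin2_cos2 ph).
unfold Rsqr in H1, H2.
assert (E : r * r = r * r * (sin th * sin th *
  (sin ph * sin ph + cos ph * cos ph) + cos th * cos th)).
{ rewrite H2, Rmult_1_r, H1; ring. }
split; rewrite <- (sqrt_square r) at 4 by lra; f_equal; rewrite E; ring.
Qed.

Lemma chart_metric (M : R) (k : axis) (p : R4) (a b : idx) : 0 < M ->
  chart_dom M p -> pullback k (global_metric M) p a b = metric M p a b.
Proof.
intros HM; destruct p as [[[t r] th] ph]; intros [Hr _].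
destruct (chart_radius r th ph ltac:(lra)) as [Ez Ex].
assert (Hc : forall u, cos u ^ 2 = 1 - sin u ^ 2).
{ intros u; assert (H := sin2_cos2 u); unfold Rsqr in H; nra. }
unfold pullback, sum4; rewrite !jacE.
destruct k; unfold global_metric, chart; cbv zeta;
  [rewrite Ez | rewrite Ex]; destruct a, b; simpl coord;
  unfold metric; field_simplify_eq; try (repeat split; lra);
  try ring [(Hc th) (Hc ph)].
Qed.

Lemma chart_Y (k : axis) (p : R4) (a b : idx) :
  pullback k global_Y p a b = Y p a b.
Proof.
destruct p as [[[t r] th] ph].
assert (Hc : forall u, cos u ^ 2 = 1 - sin u ^ 2).
{ intros u; assert (H := sin2_cos2 u); unfold Rsqr in H; nra. }
assert (Hd : forall i c q, dcoord i c q =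
  match i, c with i0, i0 | i1, i1 | i2, i2 | i3, i3 => 1 | _, _ => 0 end).
{ intros i c [[[q0 q1] q2] q3]; unfold dcoord, pd; destruct i, c; simpl;
    apply is_derive_unique; auto_derive; auto; ring. }
unfold pullback, sum4, Y, asym2; rewrite !jacE, !Hd.
destruct k; unfold global_Y, chart; destruct a, b; field_simplify_eq;
  ring [(Hc th) (Hc ph)].
Qed.

(* Main.v *)
Require Import Defs.
From Stdlib Require Import Reals Lra List.
From Coquelicot Require Import Coquelicot.
Import ListNotations.
Open Scope R_scope.

(** Write f = 1 - 2M/r and e = +1 or -1 for the orientation.  Since
    U = - d(log r), the combination [weighted_div], U^b Z_ab + nabla^b Z_ab, is
    r nabla^b(Z_ab / r), and
      beta = - (1/2) (weighted_div Z + i weighted_div *Z).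
    The real and the imaginary part of beta satisfy two equations.

    - nabla^a(beta_a / r) = 0, because the double divergence of a 2-form
      vanishes: partial derivatives commute ([div_div_antisym],
      [weighted_div_div]).
    - d(r beta) = 0.  The commutator of *F with Y kills the tr and
      theta-phi components of F and rotates the four mixed ones, so
      [weighted_div] takes exactly those combinations of first derivatives
      of F_tI and F_rI (I = theta, phi) which Maxwell's equations turn into
      derivatives of F_tr and F_{theta phi}.  The outcome
      ([weighted_div_Zten]) is
        r beta = (1/3) d(e r^2 F_tr + i F_{theta phi} / sin theta).

    For a real 1-form b with nabla^a(b_a / r) = 0 and d(r b) = 0, that is
    nabla^a b_a = - U^a b_a and
    nabla_a b_b - nabla_b b_a = U_a b_b - U_b b_a, the product rule shows
    that T_ab = b_a b_b - (1/2) g_ab b^c b_c has divergence - U_a b^c b_c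
    ([div2_stress]).  Moreover H is real and is the sum of the tensors T
    belonging to Re beta and Im beta ([Hten_parts]), which gives the first
    equation.

    The rest is standard.  U has no t component, whence the second equation.
    As d/dt is a Killing field and H is symmetric, the divergence of the
    current equals xi^a nabla^b H_ab ([div1_killing]).  Each T satisfies the
    dominant energy condition, by the Cauchy-Schwarz inequality on the
    spatial part of the metric ([stress_positive]). *)

(** * Partial derivatives and C^k functions on an open set *)

Definition ex_pd (i : idx) (f : R4 -> R) (p : R4) : Prop :=
  ex_derive (fun x => f (upd i x p)) (coord i p).

(** Unlike [smooth_on], which quantifies over words of partial derivatives,
    this recursion on the order lets the Leibniz rule prove closure under
    products and quotients by induction. *)
Fixpoint Ck (n : nat) (D : R4 -> Prop) (f : R4 -> R) : Prop :=
  (forall p, D p -> continuous f p) /\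
  match n with
  | O => True
  | S m => (forall i p, D p -> ex_pd i f p) /\ (forall i, Ck m D (pd i f))
  end.

Lemma upd_coord (i : idx) (p : R4) : upd i (coord i p) p = p.
Proof. destruct p as [[[t r] th] ph], i; reflexivity. Qed.

Lemma continuous_pair {T U V : UniformSpace} (f : T -> U) (g : T -> V) (x : T) :
  continuous f x -> continuous g x -> continuous (fun y => (f y, g y)) x.
Proof.
intros Hf Hg.
apply (filterlim_locally (fun y => (f y, g y))); intros eps.
generalize (filter_and _ _ (proj1 (filterlim_locally _ _) Hf eps)
  (proj1 (filterlim_locally _ _) Hg eps)); apply filter_imp.
intros y [Hfy Hgy]; split; assumption.
Qed.

Lemma continuous_coord (i : idx) (p : R4) : continuous (coord i) p.
Proof.
destruct p as [[[t r] th] ph].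
assert (C1 : continuous (fun q : R * R * R * R => fst q) (t, r, th, ph))
  by exact (continuous_fst (t, r, th) ph).
assert (C2 := continuous_comp _ (fun q : R * R * R => fst q) (t, r, th, ph) C1
  (continuous_fst (t, r) th)).
destruct i.
- apply (continuous_ext (fun q : R4 => fst (fst (fst q))));
    [intros [[[? ?] ?] ?]; reflexivity|].
  exact (continuous_comp _ fst (t, r, th, ph) C2 (continuous_fst t r)).
- apply (continuous_ext (fun q : R4 => snd (fst (fst q))));
    [intros [[[? ?] ?] ?]; reflexivity|].
  exact (continuous_comp _ snd (t, r, th, ph) C2 (continuous_snd t r)).
- apply (continuous_ext (fun q : R4 => snd (fst q)));
    [intros [[[? ?] ?] ?]; reflexivity|].
  exact (continuous_comp _ snd (t, r, th, ph) C1 (continuous_snd (t, r) th)).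
- apply (continuous_ext (fun q : R4 => snd q));
    [intros [[[? ?] ?] ?]; reflexivity|].
  exact (continuous_snd (t, r, th) ph).
Qed.

Lemma continuous_upd (i : idx) (x : R) (p : R4) :
  continuous (fun y : R => upd i y p) x.
Proof.
destruct p as [[[t r] th] ph], i; simpl;
  repeat first [ apply continuous_id | apply continuous_const
               | apply @continuous_pair ].
Qed.

Lemma open_line (D : R4 -> Prop) (HD : open D) (i : idx) (p : R4) : D p ->
  locally (coord i p) (fun x => D (upd i x p)).
Proof.
intros Hp; apply (continuous_upd i (coord i p) p).
rewrite upd_coord; apply HD; exact Hp.
Qed.

Lemma pd_ext (D : R4 -> Prop) (HD : open D) (f g : R4 -> R) (i : idx) (p : R4) :
  D p -> (forall q, D q -> f q = g q) -> pd i f p = pd i g p.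
Proof.
intros Hp H; apply Derive_ext_loc.
generalize (open_line D HD i p Hp); apply filter_imp; auto.
Qed.

Lemma ex_pd_ext (D : R4 -> Prop) (HD : open D) (f g : R4 -> R) (i : idx)
    (p : R4) :
  D p -> (forall q, D q -> f q = g q) -> ex_pd i f p -> ex_pd i g p.
Proof.
intros Hp H; apply ex_derive_ext_loc.
generalize (open_line D HD i p Hp); apply filter_imp; auto.
Qed.

Lemma pd_plus (f g : R4 -> R) (i : idx) (p : R4) : ex_pd i f p -> ex_pd i g p ->
  pd i (fun q => f q + g q) p = pd i f p + pd i g p.
Proof. intros Hf Hg; exact (Derive_plus _ _ _ Hf Hg). Qed.

Lemma ex_pd_plus (f g : R4 -> R) (i : idx) (p : R4) : ex_pd i f p ->
  ex_pd i g p -> ex_pd i (fun q => f q + g q) p.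
Proof. intros Hf Hg; exact (ex_derive_plus _ _ _ Hf Hg). Qed.

Lemma pd_mult (f g : R4 -> R) (i : idx) (p : R4) : ex_pd i f p -> ex_pd i g p ->
  pd i (fun q => f q * g q) p = pd i f p * g p + f p * pd i g p.
Proof.
intros Hf Hg; unfold pd; rewrite (Derive_mult _ _ _ Hf Hg), upd_coord.
reflexivity.
Qed.

Lemma ex_pd_mult (f g : R4 -> R) (i : idx) (p : R4) : ex_pd i f p ->
  ex_pd i g p -> ex_pd i (fun q => f q * g q) p.
Proof. intros Hf Hg; exact (ex_derive_mult _ _ _ Hf Hg). Qed.

Lemma pd_const (c : R) (i : idx) (p : R4) : pd i (fun _ => c) p = 0.
Proof. exact (Derive_const c _). Qed.

Lemma ex_pd_const (c : R) (i : idx) (p : R4) : ex_pd i (fun _ => c) p.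
Proof. unfold ex_pd; apply ex_derive_const. Qed.

Lemma pd_scal (c : R) (f : R4 -> R) (i : idx) (p : R4) :
  pd i (fun q => c * f q) p = c * pd i f p.
Proof. apply Derive_scal. Qed.

Lemma pd_opp (f : R4 -> R) (i : idx) (p : R4) :
  pd i (fun q => - f q) p = - pd i f p.
Proof. apply Derive_opp. Qed.

Lemma Ck_cont (n : nat) (D : R4 -> Prop) (f : R4 -> R) (p : R4) :
  Ck n D f -> D p -> continuous f p.
Proof. destruct n; intros H; apply H. Qed.

Lemma Ck_ext (D : R4 -> Prop) (HD : open D) (n : nat) : forall f g : R4 -> R,
  (forall q, D q -> f q = g q) -> Ck n D f -> Ck n D g.
Proof.
induction n as [|n IH]; intros f g E H; split.
1, 3: intros p Hp; apply (continuous_ext_loc g f);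
  [generalize (HD p Hp); apply filter_imp; auto | apply H, Hp].
- exact I.
- destruct H as [Hc [Hex Hpd]]; split.
  + intros i p Hp; apply (ex_pd_ext D HD f g); auto.
  + intros i; apply (IH (pd i f)); auto.
    intros q Hq; apply (pd_ext D HD); auto.
Qed.

Lemma Ck_pred (D : R4 -> Prop) (n : nat) : forall f, Ck (S n) D f -> Ck n D f.
Proof.
induction n as [|n IH]; intros f [Hc [Hex Hpd]]; split; auto.
Qed.

Lemma Ck_const (D : R4 -> Prop) (HD : open D) (n : nat) :
  forall c : R, Ck n D (fun _ => c).
Proof.
induction n as [|n IH]; intros c; split; try (intros; apply continuous_const).
- exact I.
- split; [intros; apply ex_pd_const|].
  intros i; apply (Ck_ext D HD n (fun _ => 0)); [|apply IH].
  intros q _; symmetry; apply pd_const.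
Qed.

Lemma Ck_plus (D : R4 -> Prop) (HD : open D) (n : nat) : forall f g,
  Ck n D f -> Ck n D g -> Ck n D (fun q => f q + g q).
Proof.
induction n as [|n IH]; intros f g Hf Hg; split.
1, 3: intros p Hp; apply (@continuous_plus _ R_AbsRing R_NormedModule);
  [apply (Ck_cont _ _ _ _ Hf Hp) | apply (Ck_cont _ _ _ _ Hg Hp)].
- exact I.
- destruct Hf as [_ [Hf Hf']], Hg as [_ [Hg Hg']]; split.
  + intros i p Hp; apply ex_pd_plus; auto.
  + intros i; apply (Ck_ext D HD n (fun q => pd i f q + pd i g q)); auto.
    intros q Hq; rewrite pd_plus; auto.
Qed.

Lemma Ck_mult (D : R4 -> Prop) (HD : open D) (n : nat) : forall f g,
  Ck n D f -> Ck n D g -> Ck n D (fun q => f q * g q).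
Proof.
induction n as [|n IH]; intros f g Hf Hg; split.
1, 3: intros p Hp; apply (@continuous_mult _ R_AbsRing);
  [apply (Ck_cont _ _ _ _ Hf Hp) | apply (Ck_cont _ _ _ _ Hg Hp)].
- exact I.
- assert (Kf := Ck_pred _ _ _ Hf); assert (Kg := Ck_pred _ _ _ Hg).
  destruct Hf as [_ [Hf Hf']], Hg as [_ [Hg Hg']]; split.
  + intros i p Hp; apply ex_pd_mult; auto.
  + intros i; apply (Ck_ext D HD n
      (fun q => pd i f q * g q + f q * pd i g q)).
    * intros q Hq; rewrite pd_mult; auto.
    * apply (Ck_plus D HD); auto.
Qed.

Lemma Ck_inv (D : R4 -> Prop) (HD : open D) (n : nat) : forall f,
  (forall q, D q -> f q <> 0) -> Ck n D f -> Ck n D (fun q => / f q).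
Proof.
induction n as [|n IH]; intros f Hn Hf; split.
1, 3: intros p Hp; apply (continuous_comp f Rinv);
  [apply (Ck_cont _ _ _ _ Hf Hp) | apply continuous_Rinv; auto].
- exact I.
- assert (Kf := Ck_pred _ _ _ Hf); destruct Hf as [_ [Hf Hf']]; split.
  + intros i p Hp; apply (ex_derive_inv (fun x => f (upd i x p))).
    * apply Hf, Hp.
    * rewrite upd_coord; auto.
  + intros i; apply (Ck_ext D HD n
      (fun q => (-1) * (pd i f q * (/ f q * / f q)))).
    * intros q Hq; unfold pd.
      rewrite (Derive_inv (fun x => f (upd i x q)));
        [|apply Hf, Hq | rewrite upd_coord; auto].
      rewrite upd_coord; field; auto.
    * repeat apply (Ck_mult D HD); auto; apply (Ck_const D HD).
Qed.

(** Sine and cosine are treated together, each being the derivative of the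
    other up to sign. *)
Lemma Ck_sin_cos (D : R4 -> Prop) (HD : open D) (n : nat) : forall f,
  Ck n D f -> Ck n D (fun q => sin (f q)) /\ Ck n D (fun q => cos (f q)).
Proof.
induction n as [|n IH]; intros f Hf.
- repeat split; intros p Hp;
    [ apply (continuous_comp f sin); [apply Hf, Hp | apply continuous_sin]
    | apply (continuous_comp f cos); [apply Hf, Hp | apply continuous_cos] ].
- assert (Kf := Ck_pred _ _ _ Hf); destruct (IH f Kf) as [Hs Hc].
  assert (Ds : forall i p, D p -> is_derive (fun x => sin (f (upd i x p)))
    (coord i p) (pd i f p * cos (f p))).
  { intros i p Hp; destruct Hf as [_ [Hf _]]; rewrite <- (upd_coord i p) at 3.
    apply (is_derive_comp sin (fun x => f (upd i x p)));
      [apply is_derive_sin | apply Derive_correct, Hf, Hp]. }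
  assert (Dc : forall i p, D p -> is_derive (fun x => cos (f (upd i x p)))
    (coord i p) (pd i f p * (- sin (f p)))).
  { intros i p Hp; destruct Hf as [_ [Hf _]]; rewrite <- (upd_coord i p) at 3.
    apply (is_derive_comp cos (fun x => f (upd i x p)));
      [apply is_derive_cos | apply Derive_correct, Hf, Hp]. }
  destruct Hf as [Hf0 [Hf Hf']].
  split; (split; [|split]).
  + intros p Hp; apply (continuous_comp f sin);
      [apply Hf0, Hp | apply continuous_sin].
  + intros i p Hp; eexists; apply Ds, Hp.
  + intros i; apply (Ck_ext D HD n (fun q => pd i f q * cos (f q))).
    * intros q Hq; symmetry; apply is_derive_unique, Ds, Hq.
    * apply (Ck_mult D HD); auto.
  + intros p Hp; apply (continuous_comp f cos);
      [apply Hf0, Hp | apply continuous_cos].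
  + intros i p Hp; eexists; apply Dc, Hp.
  + intros i; apply (Ck_ext D HD n (fun q => -1 * (pd i f q * sin (f q)))).
    * intros q Hq; symmetry; transitivity (pd i f q * - sin (f q)); [|ring].
      apply is_derive_unique, Dc, Hq.
    * repeat apply (Ck_mult D HD); auto; apply (Ck_const D HD).
Qed.

Lemma dcoordE (i a : idx) (p : R4) : dcoord i a p =
  match i, a with i0, i0 | i1, i1 | i2, i2 | i3, i3 => 1 | _, _ => 0 end.
Proof.
destruct p as [[[t r] th] ph]; unfold dcoord, pd; destruct i, a; simpl;
  apply is_derive_unique; auto_derive; auto; ring.
Qed.

Lemma Ck_coord (D : R4 -> Prop) (HD : open D) (n : nat) (i : idx) :
  Ck n D (coord i).
Proof.
destruct n; split; try (intros; apply continuous_coord); [exact I|split].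
- intros a [[[t r] th] ph] _; unfold ex_pd; destruct i, a; simpl; auto_derive;
    auto.
- intros a; apply (Ck_ext D HD n (fun _ => match i, a with
    i0, i0 | i1, i1 | i2, i2 | i3, i3 => 1 | _, _ => 0 end)).
  + intros q _; symmetry; apply dcoordE.
  + apply (Ck_const D HD).
Qed.

Lemma smooth_on_pd (D : R4 -> Prop) (f : R4 -> R) (i : idx) :
  smooth_on D f -> smooth_on D (pd i f).
Proof.
intros H l; replace (pds l (pd i f)) with (pds (l ++ [i]) f); [apply H|].
induction l as [|j l IH]; simpl; [reflexivity | rewrite IH; reflexivity].
Qed.

Lemma smooth_on_Ck (D : R4 -> Prop) (n : nat) : forall f : R4 -> R,
  smooth_on D f -> Ck n D f.
Proof.
induction n as [|n IH]; intros f H; split;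
  try (intros p Hp; apply (H [] p Hp)); [exact I|split].
- intros i p Hp; apply (H [] p Hp).
- intros i; apply IH, smooth_on_pd, H.
Qed.

Lemma pd_comm (D : R4 -> Prop) (HD : open D) (f : R4 -> R) (i j : idx) (p : R4) :
  Ck 2 D f -> D p -> pd i (pd j f) p = pd j (pd i f) p.
Proof.
intros [_ [H1 H2]] Hp.
assert (Hex : forall a b q, D q -> ex_pd a (pd b f) q).
{ intros a b q Hq; apply (H2 b), Hq. }
assert (Hc : forall a b q, D q -> continuous (pd a (pd b f)) q).
{ intros a b q Hq; apply (H2 b), Hq. }
(* The restriction of f to the (i,j)-coordinate plane through p. *)
assert (C2 : forall z : R * R,
  continuous (fun z : R * R => upd j (snd z) (upd i (fst z) p)) z).
{ intros z; destruct p as [[[t r] th] ph], i, j; simpl;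
  repeat first [ apply continuous_fst | apply continuous_snd
               | apply continuous_const | apply @continuous_pair ]. }
assert (P : (fun z : R * R => upd j (snd z) (upd i (fst z) p))
  (coord i p, coord j p) = p).
{ destruct p as [[[t r] th] ph], i, j; reflexivity. }
assert (HL : locally_2d (fun u v => D (upd j v (upd i u p)))
  (coord i p) (coord j p)).
{ apply locally_2d_locally.
  apply (C2 (coord i p, coord j p)); rewrite P; apply HD, Hp. }
assert (HC : forall a b, continuity_2d_pt (fun u v =>
  pd a (pd b f) (upd j v (upd i u p))) (coord i p) (coord j p)).
{ intros a b; apply continuity_2d_pt_filterlim.
  apply (continuous_comp (fun z : R * R => upd j (snd z) (upd i (fst z) p))
    (pd a (pd b f)) (coord i p, coord j p)); [apply C2|].
  rewrite P; apply Hc, Hp. }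
assert (S := Schwarz (fun u v => f (upd j v (upd i u p)))
  (coord i p) (coord j p)).
assert (HC1 := HC i j); assert (HC2 := HC j i).
assert (Ei := H1 i); assert (Ej := H1 j).
assert (Eij := Hex i j); assert (Eji := Hex j i).
destruct p as [[[t r] th] ph], i, j; try reflexivity;
  (apply S; [ | exact HC1 | exact HC2 ];
   revert HL; apply locally_2d_impl, locally_2d_forall;
   intros u v Hq; repeat split;
   [ exact (Ei _ Hq) | exact (Ej _ Hq) | exact (Eij _ Hq)
   | exact (Eji _ Hq) ]).
Qed.

Lemma open_chart_dom (M : R) : open (chart_dom M).
Proof.
assert (H : open (fun p : R4 => 2 * M < coord i1 p /\
  0 < coord i2 p /\ coord i2 p < PI)).
{ repeat apply @open_and.
  - apply (open_comp (coord i1) (fun x => 2 * M < x));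
      [intros; apply continuous_coord | apply open_gt].
  - apply (open_comp (coord i2) (fun x => 0 < x));
      [intros; apply continuous_coord | apply open_gt].
  - apply (open_comp (coord i2) (fun x => x < PI));
      [intros; apply continuous_coord | apply open_lt]. }
intros p Hp; generalize (H p).
destruct p as [[[t r] th] ph]; intros H'; specialize (H' Hp).
revert H'; apply filter_imp; intros [[[t' r'] th'] ph'] K; exact K.
Qed.

(** * The Schwarzschild connection *)

Lemma chart_dom_pos (M t r th ph : R) : 0 < M -> chart_dom M (t, r, th, ph) ->
  2 * M < r /\ 0 < sin th.
Proof.
intros HM [Hr Hth]; split; [exact Hr | apply sin_gt_0; apply Hth].
Qed.

Lemma lapse_pos (M r : R) : 0 < M -> 2 * M < r -> 0 < 1 - 2 * M / r.
Proof.
intros HM Hr; replace (1 - 2 * M / r) with ((r - 2 * M) / r) by (field; lra).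
apply Rdiv_lt_0_compat; lra.
Qed.

(** The shape in which [auto_derive] asks for the lapse to be nonzero. *)
Lemma lapse_neq (M r : R) : 0 < M -> 2 * M < r -> 1 + - (2 * M * / r) <> 0.
Proof. intros HM Hr; exact (Rgt_not_eq _ _ (lapse_pos M r HM Hr)). Qed.

Lemma chart_dom_neq (M : R) (q : R4) : 0 < M -> chart_dom M q ->
  coord i1 q <> 0 /\ sin (coord i2 q) <> 0 /\ 1 + -2 * M * / coord i1 q <> 0.
Proof.
destruct q as [[[t r] th] ph]; intros HM Hq.
destruct (chart_dom_pos _ _ _ _ _ HM Hq) as (Hr & Hs); simpl.
repeat split; [lra | lra |].
replace (1 + -2 * M * / r) with (1 - 2 * M / r) by (field; lra).
apply Rgt_not_eq, lapse_pos; assumption.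
Qed.

Ltac nonzero := repeat split; auto;
  repeat apply Rmult_integral_contrapositive_currified; lra.

Lemma pd_metric (M t r th ph : R) (c a b : idx) : 0 < M -> 2 * M < r ->
  pd c (fun q => metric M q a b) (t, r, th, ph) =
  match c, a, b with
  | i1, i0, i0 => 2 * M / r ^ 2
  | i1, i1, i1 => 2 * M / (r - 2 * M) ^ 2
  | i1, i2, i2 => - (2 * r)
  | i1, i3, i3 => - (2 * r * sin th ^ 2)
  | i2, i3, i3 => - (2 * r ^ 2 * sin th * cos th)
  | _, _, _ => 0
  end.
Proof.
intros HM Hr.
assert (H := lapse_neq M r HM Hr).
destruct c, a, b; unfold pd; simpl;
  first [ apply Derive_const
        | apply is_derive_unique; auto_derive;
          [ repeat split; auto; lra | field; repeat split; lra ] ].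
Qed.

Lemma pd_inv_metric (M t r th ph : R) (c a : idx) : 0 < M -> 2 * M < r ->
  0 < sin th ->
  pd c (fun q => inv_metric M q a a) (t, r, th, ph) =
  match c, a with
  | i1, i0 => - (2 * M / (r - 2 * M) ^ 2)
  | i1, i1 => - (2 * M / r ^ 2)
  | i1, i2 => 2 / r ^ 3
  | i1, i3 => 2 / (r ^ 3 * sin th ^ 2)
  | i2, i3 => 2 * cos th / (r ^ 2 * sin th ^ 3)
  | _, _ => 0
  end.
Proof.
intros HM Hr Hs.
assert (H := lapse_neq M r HM Hr).
destruct c, a; unfold pd; simpl;
  first [ apply Derive_const
        | apply is_derive_unique; auto_derive;
          [ nonzero | field; repeat split; lra ] ].
Qed.

Lemma ex_pd_metric (M t r th ph : R) (c a b : idx) : 0 < M -> 2 * M < r ->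
  ex_pd c (fun q => metric M q a b) (t, r, th, ph).
Proof.
intros HM Hr.
assert (H := lapse_neq M r HM Hr).
unfold ex_pd; destruct c, a, b; simpl; auto_derive; repeat split; auto; lra.
Qed.

Lemma ex_pd_inv_metric (M t r th ph : R) (c a : idx) : 0 < M -> 2 * M < r ->
  0 < sin th -> ex_pd c (fun q => inv_metric M q a a) (t, r, th, ph).
Proof.
intros HM Hr Hs.
assert (H := lapse_neq M r HM Hr).
unfold ex_pd; destruct c, a; simpl; auto_derive; nonzero.
Qed.

(** The Christoffel symbols are rational in r, sin theta and cos theta, so
    that every later tensor identity at a point is a field identity. *)
Lemma christoffelE (M t r th ph : R) (c a b : idx) : 0 < M -> 2 * M < r ->
  0 < sin th ->
  christoffel M (t, r, th, ph) c a b =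
  match c, a, b with
  | i0, i0, i1 | i0, i1, i0 => M / (r * (r - 2 * M))
  | i1, i0, i0 => M * (r - 2 * M) / r ^ 3
  | i1, i1, i1 => - (M / (r * (r - 2 * M)))
  | i1, i2, i2 => - (r - 2 * M)
  | i1, i3, i3 => - ((r - 2 * M) * sin th ^ 2)
  | i2, i1, i2 | i2, i2, i1 | i3, i1, i3 | i3, i3, i1 => / r
  | i2, i3, i3 => - (sin th * cos th)
  | i3, i2, i3 | i3, i3, i2 => cos th / sin th
  | _, _, _ => 0
  end.
Proof.
intros HM Hr Hs; unfold christoffel, sum4.
rewrite !pd_metric by assumption.
destruct c, a, b; simpl; field; repeat split; lra.
Qed.

Lemma div2_diag (M : R) (T : tensor2) (p : R4) (a : idx) :
  div2 M T p a = sum4 (fun b => inv_metric M p b b * nabla2 M T p b a b).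
Proof.
destruct p as [[[t r] th] ph]; unfold div2, sum4; simpl inv_metric; ring.
Qed.

(** * The stress tensor of a one-form *)

Definition sqnorm (M : R) (b : tensor1) (q : R4) : R :=
  sum4 (fun d => inv_metric M q d d * (b q d * b q d)).

(** The energy-momentum tensor of a scalar field whose gradient is b. *)
Definition stress (M : R) (b : tensor1) : tensor2 := fun q a c =>
  b q a * b q c + (- / 2) * (metric M q a c * sqnorm M b q).

Lemma pd_stress (M : R) (b : tensor1) (p : R4) (c a e : idx) : 0 < M ->
  chart_dom M p -> (forall i, ex_pd c (fun q => b q i) p) ->
  ex_pd c (fun q => stress M b q a e) p /\
  pd c (fun q => stress M b q a e) p =
    pd c (fun q => b q a) p * b p e + b p a * pd c (fun q => b q e) p
    + (- / 2) * (pd c (fun q => metric M q a e) p * sqnorm M b p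
      + metric M p a e * sum4 (fun d =>
          pd c (fun q => inv_metric M q d d) p * (b p d * b p d)
          + inv_metric M p d d * (pd c (fun q => b q d) p * b p d
                                  + b p d * pd c (fun q => b q d) p))).
Proof.
destruct p as [[[t r] th] ph]; intros HM Hp Hb.
destruct (chart_dom_pos _ _ _ _ _ HM Hp) as (Hr & Hs).
set (p := (t, r, th, ph)) in *.
assert (Hd : forall d, ex_pd c (fun q => inv_metric M q d d * (b q d * b q d)) p).
{ intros d; apply ex_pd_mult; [apply ex_pd_inv_metric; auto|].
  apply ex_pd_mult; apply Hb. }
assert (Ed : forall d, pd c (fun q => inv_metric M q d d * (b q d * b q d)) p =
  pd c (fun q => inv_metric M q d d) p * (b p d * b p d)
          + inv_metric M p d d * (pd c (fun q => b q d) p * b p d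
                                  + b p d * pd c (fun q => b q d) p)).
{ intros d; rewrite pd_mult, pd_mult; [reflexivity| apply Hb | apply Hb | |].
  - apply ex_pd_inv_metric; auto.
  - apply ex_pd_mult; apply Hb. }
assert (Hn : ex_pd c (sqnorm M b) p).
{ exact (ex_pd_plus _ _ _ _ (ex_pd_plus _ _ _ _ (ex_pd_plus _ _ _ _
    (Hd i0) (Hd i1)) (Hd i2)) (Hd i3)). }
assert (En : pd c (sqnorm M b) p = sum4 (fun d =>
          pd c (fun q => inv_metric M q d d) p * (b p d * b p d)
          + inv_metric M p d d * (pd c (fun q => b q d) p * b p d
                                  + b p d * pd c (fun q => b q d) p))).
{ unfold sqnorm, sum4; rewrite !pd_plus, !Ed; auto;
    [apply ex_pd_plus; auto|].
  apply ex_pd_plus; [apply ex_pd_plus|]; auto. }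
assert (Hg := ex_pd_metric M t r th ph c a e HM Hr).
split.
- apply ex_pd_plus; [apply ex_pd_mult; auto|].
  apply ex_pd_mult; [apply ex_pd_const | apply ex_pd_mult; auto].
- unfold stress; rewrite pd_plus, pd_mult, pd_scal, pd_mult, En; auto.
  + apply ex_pd_mult; auto.
  + apply ex_pd_mult; [apply ex_pd_const | apply ex_pd_mult; auto].
Qed.

(** The two hypotheses say d(r b) = 0 and nabla^a(b_a / r) = 0, the latter in
    the form |det g|^(-1/2) d_a(|det g|^(1/2) g^ab b_b / r) = 0.  Without the
    factors of r they would be the equations of the gradient of a solution of
    the wave equation, whose stress tensor is conserved; the factors of r
    produce the term in U = - d(log r). *)
Lemma div2_stress (M : R) (b : tensor1) (p : R4) (a : idx) : 0 < M ->
  chart_dom M p -> (forall c i, ex_pd c (fun q => b q i) p) ->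
  (forall c e, pd c (fun q => coord i1 q * b q e) p =
               pd e (fun q => coord i1 q * b q c) p) ->
  sum4 (fun c => pd c (fun q => coord i1 q ^ 2 * sin (coord i2 q) *
    inv_metric M q c c * (/ coord i1 q * b q c)) p) = 0 ->
  div2 M (stress M b) p a = - U p a * sqnorm M b p.
Proof.
destruct p as [[[t r] th] ph]; intros HM Hp Hb Hcurl Hdiv.
destruct (chart_dom_pos _ _ _ _ _ HM Hp) as (Hr & Hs).
set (p := (t, r, th, ph)) in *.
(* Both hypotheses are expanded with the product rule into relations between
   the first derivatives of b. *)
assert (Kcurl : forall c e, r * pd c (fun q => b q e) p =
  r * pd e (fun q => b q c) p + dcoord i1 e p * b p c - dcoord i1 c p * b p e).
{ assert (K : forall c, ex_pd c (coord i1) p).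
  { intros c; unfold ex_pd, p; destruct c; simpl; auto_derive; auto. }
  intros c e; assert (H := Hcurl c e).
  rewrite !pd_mult in H by auto.
  change (pd ?x (coord i1) p) with (dcoord i1 x p) in H.
  change (coord i1 p) with r in H; lra. }
assert (Hf := lapse_neq M r HM Hr).
assert (Kdiv : pd i0 (fun q => b q i0) p =
  (1 - 2 * M / r) / r * b p i1
  + (1 - 2 * M / r) ^ 2 * pd i1 (fun q => b q i1) p
  + (1 - 2 * M / r) / r ^ 2 * (pd i2 (fun q => b q i2) p
      + cos th / sin th * b p i2 + pd i3 (fun q => b q i3) p / sin th ^ 2)).
{ assert (Ew : forall c, ex_pd c (fun q => coord i1 q ^ 2 * sin (coord i2 q) *
    inv_metric M q c c * / coord i1 q) p /\
    pd c (fun q => coord i1 q ^ 2 * sin (coord i2 q) *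
    inv_metric M q c c * / coord i1 q) p = match c with
      i1 => - sin th | i2 => - cos th / r | _ => 0 end).
  { intros c; split; [unfold ex_pd | unfold pd]; unfold p;
      destruct c; simpl;
      first [ auto_derive; nonzero
            | apply is_derive_unique; auto_derive;
              [ nonzero | field; repeat split; lra ] ]. }
  assert (Et : forall c, pd c (fun q => coord i1 q ^ 2 * sin (coord i2 q) *
    inv_metric M q c c * (/ coord i1 q * b q c)) p =
    match c with
      i1 => - sin th | i2 => - cos th / r | _ => 0 end * b p c +
    r * sin th * inv_metric M p c c * pd c (fun q => b q c) p).
  { intros c; destruct (Ew c) as [W1 W2].
    transitivity (pd c (fun q => coord i1 q ^ 2 * sin (coord i2 q) *
      inv_metric M q c c * / coord i1 q * b q c) p).
    - apply Derive_ext; intros x; ring.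
    - rewrite pd_mult, W2 by auto; f_equal; f_equal.
      unfold p; simpl; field; lra. }
  unfold sum4 in Hdiv; rewrite !Et in Hdiv; simpl in Hdiv.
  apply Rminus_diag_uniq.
  match type of Hdiv with ?L = 0 =>
    transitivity ((1 - 2 * M / r) / (r * sin th) * L) end.
  - field; repeat split; lra.
  - rewrite Hdiv; ring. }
rewrite div2_diag; unfold sum4, nabla2, sum4.
unfold p; rewrite !christoffelE by assumption; fold p.
rewrite !(fun c a e => proj2 (pd_stress M b p c a e HM Hp (Hb c))).
unfold p; rewrite !pd_metric by assumption; fold p.
unfold sum4.
unfold p; rewrite !pd_inv_metric by assumption; fold p.
unfold U, stress, sqnorm, sum4; rewrite dcoordE.
(* Eliminating six off-diagonal derivatives and d_t b_t leaves an identity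
   between independent quantities. *)
assert (Ks : forall c e, pd c (fun q => b q e) p =
  pd e (fun q => b q c) p + (dcoord i1 e p * b p c - dcoord i1 c p * b p e) / r).
{ intros c e; apply (Rmult_eq_reg_l r); [|lra].
  rewrite Kcurl; field; lra. }
assert (K01 := Ks i0 i1); assert (K02 := Ks i0 i2).
assert (K03 := Ks i0 i3); assert (K12 := Ks i1 i2).
assert (K13 := Ks i1 i3); assert (K23 := Ks i2 i3).
rewrite !dcoordE in *.
clear Kcurl Ks Hcurl Hdiv Hb.
destruct a; rewrite ?K01, ?K02, ?K03, ?K12, ?K13, ?K23, ?Kdiv;
  unfold p; simpl inv_metric; simpl metric; simpl coord; fold p.
all: field; repeat split; lra.
Qed.

(** * The weighted divergence of a two-form *)

Definition antisym_on (D : R4 -> Prop) (T : tensor2) : Prop :=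
  forall q, D q -> forall a b, T q a b = - T q b a.

(** This is r nabla^b(Z_ab / r). *)
Definition weighted_div (M : R) (Z : tensor2) : tensor1 := fun q a =>
  sum4 (fun b => raise1 M U q b * Z q a b) + div2 M Z q a.

(** |det g|^(1/2) g^aa g^bb / r, which turns the covariant divergence of the
    antisymmetric tensor Z_ab / r into the coordinate divergence of
    [weight M a b * Z a b]. *)
Definition weight (M : R) (a b : idx) (q : R4) : R :=
  coord i1 q ^ 2 * sin (coord i2 q) * inv_metric M q a a * inv_metric M q b b
  * / coord i1 q.

Lemma antisym_diag (D : R4 -> Prop) (T : tensor2) (q : R4) (a : idx) :
  antisym_on D T -> D q -> T q a a = 0.
Proof. intros H Hq; assert (K := H q Hq a a); lra. Qed.

Lemma pd_antisym (D : R4 -> Prop) (HD : open D) (T : tensor2) (q : R4)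
    (c a b : idx) : antisym_on D T -> D q ->
  pd c (fun q => T q a b) q = - pd c (fun q => T q b a) q.
Proof.
intros H Hq; rewrite <- pd_opp; apply (pd_ext D HD); auto.
Qed.

Lemma raise1_U (M : R) (p : R4) (b : idx) : raise1 M U p b =
  match b with i1 => - inv_metric M p i1 i1 / coord i1 p | _ => 0 end.
Proof.
unfold raise1, sum4, U; rewrite !dcoordE.
destruct p as [[[t r] th] ph], b; simpl; unfold Rdiv; ring.
Qed.

Lemma pd_weight (M t r th ph : R) (a b : idx) : 0 < M -> 2 * M < r ->
  0 < sin th -> a <> b ->
  let f := 1 - 2 * M / r in
  ex_pd b (weight M a b) (t, r, th, ph) /\
  pd b (weight M a b) (t, r, th, ph) =
  match a, b with
  | i0, i1 => -1 * sin th
  | i0, i2 => - cos th / (r * f)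
  | i1, i2 => cos th * f / r
  | i2, i1 => 2 * M * sin th / r ^ 3 - f * sin th / r ^ 2
  | i3, i1 => 2 * M / (r ^ 3 * sin th) - f / (r ^ 2 * sin th)
  | i3, i2 => - cos th / (r ^ 3 * sin th ^ 2)
  | _, _ => 0
  end.
Proof.
intros HM Hr Hs Hab f; unfold f.
assert (Hf := lapse_neq M r HM Hr).
split; [unfold ex_pd | unfold pd]; destruct a, b; try congruence;
  unfold weight; simpl;
  first [ auto_derive; nonzero
        | apply is_derive_unique; auto_derive;
          [ nonzero | field; repeat split; lra ] ].
Qed.

(** For an antisymmetric tensor the connection enters a divergence only
    through the density |det g|^(1/2). *)
Lemma weighted_divE (M : R) (Z : tensor2) (p : R4) (a : idx) : 0 < M ->
  chart_dom M p -> antisym_on (chart_dom M) Z ->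
  (forall c a b, ex_pd c (fun q => Z q a b) p) ->
  weighted_div M Z p a = coord i1 p * metric M p a a /
    (coord i1 p ^ 2 * sin (coord i2 p)) *
    sum4 (fun b => pd b (fun q => weight M a b q * Z q a b) p).
Proof.
destruct p as [[[t r] th] ph]; intros HM Hp HZ Hex.
destruct (chart_dom_pos _ _ _ _ _ HM Hp) as (Hr & Hs).
assert (Ed : pd a (fun q => weight M a a q * Z q a a) (t, r, th, ph) = 0).
{ rewrite (pd_ext _ (open_chart_dom M) _ (fun _ => 0) _ _ Hp);
    [apply pd_const|].
  intros q Hq; rewrite (antisym_diag _ _ _ _ HZ Hq); ring. }
assert (Eo : forall b, a <> b -> pd b (fun q => weight M a b q * Z q a b)
    (t, r, th, ph) = pd b (weight M a b) (t, r, th, ph) * Z (t, r, th, ph) a b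
    + weight M a b (t, r, th, ph) * pd b (fun q => Z q a b) (t, r, th, ph)).
{ intros b Hb; rewrite pd_mult; auto.
  apply pd_weight; auto. }
assert (Zd := fun a => antisym_diag _ _ _ a HZ Hp).
assert (Za := HZ _ Hp).
assert (Zp : pd a (fun q => Z q a a) (t, r, th, ph) = 0).
{ rewrite (pd_ext _ (open_chart_dom M) _ (fun _ => 0) _ _ Hp);
    [apply pd_const|].
  intros q Hq; apply (antisym_diag _ _ _ _ HZ Hq). }
unfold weighted_div; rewrite div2_diag; unfold nabla2, sum4.
rewrite !raise1_U, !christoffelE by assumption.
set (p := (t, r, th, ph)) in *.
assert (Z10 := Za i1 i0); assert (Z20 := Za i2 i0); assert (Z30 := Za i3 i0).
assert (Z21 := Za i2 i1); assert (Z31 := Za i3 i1); assert (Z32 := Za i3 i2).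
destruct a; rewrite Ed, Zp, !Eo by congruence;
  unfold p; rewrite !(fun a b H => proj2 (pd_weight M t r th ph a b HM Hr Hs H))
    by congruence; fold p;
  rewrite !Zd, ?Z10, ?Z20, ?Z30, ?Z21, ?Z31, ?Z32; unfold weight, p; simpl;
  fold p; field; repeat split; lra.
Qed.

(** Leaves the C^k property of unknown functions and the nonvanishing of
    denominators to be proved. *)
Ltac solve_Ck HD :=
  lazymatch goal with
  | |- Ck _ _ (coord _) => apply (Ck_coord _ HD)
  | |- Ck _ _ (fun q => coord ?i q) => apply (Ck_coord _ HD _ i)
  | |- Ck _ _ (fun q => @?f q * @?g q) =>
      apply (Ck_mult _ HD _ f g); solve_Ck HD
  | |- Ck _ _ (fun q => @?f q + @?g q) =>
      apply (Ck_plus _ HD _ f g); solve_Ck HD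
  | |- Ck _ _ (fun q => / @?f q) => apply (Ck_inv _ HD _ f); [|solve_Ck HD]
  | |- Ck _ _ (fun q => sin (@?f q)) =>
      apply (Ck_sin_cos _ HD _ f); solve_Ck HD
  | |- Ck _ _ (fun _ => ?c) => apply (Ck_const _ HD)
  | |- _ => idtac
  end.

Lemma weight_Ck (M : R) (n : nat) (a b : idx) : 0 < M ->
  Ck n (chart_dom M) (weight M a b).
Proof.
intros HM; assert (HD := open_chart_dom M).
assert (Hne := fun q => chart_dom_neq M q HM).
assert (Hi : forall a, Ck n (chart_dom M) (fun q => inv_metric M q a a)).
{ intros [].
  - apply (Ck_ext _ HD n (fun q => / (1 + -2 * M * / coord i1 q)));
      [|solve_Ck HD; apply Hne].
    intros [[[t r] th] ph] _; simpl; f_equal; unfold Rdiv; ring.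
  - apply (Ck_ext _ HD n (fun q => -1 * (1 + -2 * M * / coord i1 q)));
      [|solve_Ck HD; apply Hne].
    intros [[[t r] th] ph] _; simpl; unfold Rdiv; ring.
  - apply (Ck_ext _ HD n (fun q => -1 * (/ coord i1 q * / coord i1 q)));
      [|solve_Ck HD; apply Hne].
    intros [[[t r] th] ph] Hq; destruct (Hne _ Hq); simpl in *; field; auto.
  - apply (Ck_ext _ HD n (fun q => -1 * (/ coord i1 q * / coord i1 q) *
      (/ sin (coord i2 q) * / sin (coord i2 q)))); [|solve_Ck HD; apply Hne].
    intros [[[t r] th] ph] Hq; destruct (Hne _ Hq) as (Hr & Hs & _).
    simpl in *; field; auto. }
apply (Ck_ext _ HD n (fun q => coord i1 q * sin (coord i2 q) *
  (inv_metric M q a a * inv_metric M q b b))); [|solve_Ck HD; auto].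
intros q Hq; unfold weight; field; apply Hne; auto.
Qed.

(** Commuting second derivatives are symmetric in a and b, while J is
    antisymmetric. *)
Lemma div_div_antisym (D : R4 -> Prop) (HD : open D) (J : idx -> idx -> R4 -> R)
    (p : R4) : D p -> (forall a b, Ck 2 D (J a b)) ->
  (forall q, D q -> forall a b, J a b q = - J b a q) ->
  sum4 (fun a => pd a (fun q => sum4 (fun b => pd b (J a b) q)) p) = 0.
Proof.
intros Hp HC HJ.
assert (Hx : forall c a b, ex_pd c (pd b (J a b)) p).
{ intros c a b; destruct (HC a b) as [_ [_ H]]; apply (H b), Hp. }
assert (E : forall a, pd a (fun q => sum4 (fun b => pd b (J a b) q)) p =
  sum4 (fun b => pd a (pd b (J a b)) p)).
{ intros a; unfold sum4; rewrite !pd_plus; auto;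
    [apply ex_pd_plus; auto|].
  apply ex_pd_plus; [apply ex_pd_plus|]; auto. }
assert (A : forall a b, pd a (pd b (J a b)) p = - pd b (pd a (J b a)) p).
{ intros a b; rewrite (pd_comm D HD _ a b p (HC a b) Hp), <- pd_opp.
  apply (pd_ext D HD); auto; intros q Hq; rewrite <- pd_opp.
  apply (pd_ext D HD); auto. }
unfold sum4 at 1; rewrite !E; unfold sum4.
assert (A00 := A i0 i0); assert (A11 := A i1 i1); assert (A22 := A i2 i2).
assert (A33 := A i3 i3); assert (A01 := A i0 i1); assert (A02 := A i0 i2).
assert (A03 := A i0 i3); assert (A12 := A i1 i2); assert (A13 := A i1 i3).
assert (A23 := A i2 i3); lra.
Qed.

Lemma weighted_div_div (M : R) (Z : tensor2) (p : R4) : 0 < M ->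
  chart_dom M p -> antisym_on (chart_dom M) Z ->
  (forall a b, Ck 2 (chart_dom M) (fun q => Z q a b)) ->
  sum4 (fun a => pd a (fun q => coord i1 q ^ 2 * sin (coord i2 q) *
    inv_metric M q a a * (/ coord i1 q * weighted_div M Z q a)) p) = 0.
Proof.
intros HM Hp HZ HC; assert (HD := open_chart_dom M).
rewrite <- (div_div_antisym _ HD (fun a b q => weight M a b q * Z q a b) p Hp).
- assert (E : forall a, pd a (fun q => coord i1 q ^ 2 * sin (coord i2 q) *
    inv_metric M q a a * (/ coord i1 q * weighted_div M Z q a)) p =
    pd a (fun q => sum4 (fun b => pd b (fun q => weight M a b q * Z q a b) q)) p).
  { intros a; apply (pd_ext _ HD); auto; intros q Hq.
    rewrite (weighted_divE M Z q a HM Hq HZ)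
      by (intros c d e; exact (proj1 (proj2 (HC d e)) c q Hq)).
    generalize (sum4 (fun b => pd b (fun q => weight M a b q * Z q a b) q)).
    destruct q as [[[t r] th] ph].
    destruct (chart_dom_pos _ _ _ _ _ HM Hq) as (Hr & Hs).
    intros x; destruct a; simpl; field; repeat split; lra. }
  unfold sum4 at 1 2; rewrite !E; reflexivity.
- intros a b; apply (Ck_mult _ HD); auto; apply weight_Ck; auto.
- intros q Hq a b; rewrite (HZ q Hq a b); unfold weight; ring.
Qed.

(** * Maxwell's equations in components *)

(** The Christoffel symbols cancel, since the connection has no torsion. *)
Lemma maxwell_bianchi (M : R) (G : tensor2) (p : R4) (a b c : idx) : 0 < M ->
  chart_dom M p -> antisym_on (chart_dom M) G -> maxwell_chart M G ->
  pd a (fun q => G q b c) p + pd b (fun q => G q c a) p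
  + pd c (fun q => G q a b) p = 0.
Proof.
destruct p as [[[t r] th] ph]; intros HM Hp HG HF.
destruct (chart_dom_pos _ _ _ _ _ HM Hp) as (Hr & Hs).
destruct (HF _ Hp) as [_ H]; specialize (H a b c); revert H.
assert (A := fun c a b => pd_antisym _ (open_chart_dom M) G _ c a b HG Hp).
assert (Ga := HG _ Hp).
unfold asym3, nabla2, sum4; rewrite !christoffelE by assumption.
rewrite (A a c b), (A b a c), (A c b a).
generalize (pd a (fun q => G q b c) (t, r, th, ph))
  (pd b (fun q => G q c a) (t, r, th, ph))
  (pd c (fun q => G q a b) (t, r, th, ph)); intros x y z.
assert (G10 := Ga i1 i0); assert (G20 := Ga i2 i0); assert (G30 := Ga i3 i0).
assert (G21 := Ga i2 i1); assert (G31 := Ga i3 i1); assert (G32 := Ga i3 i2).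
assert (Gd := fun a => antisym_diag _ _ _ a HG Hp).
destruct a, b, c; rewrite !Gd, ?G10, ?G20, ?G30, ?G21, ?G31, ?G32;
  intros H; lra.
Qed.

(** The equations d_a(|det g|^(1/2) F^ab) = 0 for b = t, r, theta, phi,
    expanded, up to nonvanishing factors. *)
Lemma maxwell_div (M t r th ph : R) (G : tensor2) : 0 < M ->
  chart_dom M (t, r, th, ph) -> antisym_on (chart_dom M) G ->
  maxwell_chart M G ->
  let f := 1 - 2 * M / r in
  let d c a b := pd c (fun q => G q a b) (t, r, th, ph) in
  let g a b := G (t, r, th, ph) a b in
  sin th * (r ^ 2 * d i1 i0 i1 + 2 * r * g i0 i1)
    + (sin th * d i2 i0 i2 + cos th * g i0 i2 + d i3 i0 i3 / sin th) / f = 0 /\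
  sin th * r ^ 2 * d i0 i0 i1
    + f * (sin th * d i2 i1 i2 + cos th * g i1 i2 + d i3 i1 i3 / sin th) = 0 /\
  sin th * d i0 i0 i2 / f - sin th * (f * d i1 i1 i2 + 2 * M / r ^ 2 * g i1 i2)
    + d i3 i2 i3 / (r ^ 2 * sin th) = 0 /\
  d i0 i0 i3 / f - (f * d i1 i1 i3 + 2 * M / r ^ 2 * g i1 i3)
    - (d i2 i2 i3 - cos th / sin th * g i2 i3) / r ^ 2 = 0.
Proof.
intros HM Hp HG HF f d g; subst f d g; cbv beta.
destruct (chart_dom_pos _ _ _ _ _ HM Hp) as (Hr & Hs).
destruct (HF _ Hp) as [H _].
assert (A := fun c a b => pd_antisym _ (open_chart_dom M) G _ c a b HG Hp).
assert (Ga := HG _ Hp).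
assert (G10 := Ga i1 i0); assert (G20 := Ga i2 i0); assert (G30 := Ga i3 i0).
assert (G21 := Ga i2 i1); assert (G31 := Ga i3 i1); assert (G32 := Ga i3 i2).
assert (Gd := fun a => antisym_diag _ _ _ a HG Hp).
assert (Dd : forall c a, pd c (fun q => G q a a) (t, r, th, ph) = 0).
{ intros c a; assert (K := A c a a); lra. }
assert (Hb : forall b, sum4 (fun a => inv_metric M (t, r, th, ph) a a *
  nabla2 M G (t, r, th, ph) a a b) = 0).
{ intros b; rewrite <- (H b); unfold sum4; simpl inv_metric; ring. }
assert (H0 := Hb i0); assert (H1 := Hb i1); assert (H2 := Hb i2).
assert (H3 := Hb i3); clear H Hb.
unfold nabla2, sum4 in *; rewrite !christoffelE in * by assumption.
rewrite !Gd, ?(A _ i1 i0), ?(A _ i2 i0), ?(A _ i3 i0), ?(A _ i2 i1),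
  ?(A _ i3 i1), ?(A _ i3 i2), !Dd, ?G10, ?G20, ?G30, ?G21, ?G31, ?G32 in *.
simpl inv_metric in *.
clear A Ga Gd Dd G10 G20 G30 G21 G31 G32 HF HG.
repeat split.
- match type of H0 with ?L = 0 =>
    transitivity (r ^ 2 * sin th / (1 - 2 * M / r) * L) end;
  [field; repeat split; lra | rewrite H0; ring].
- match type of H1 with ?L = 0 =>
    transitivity (r ^ 2 * sin th * (1 - 2 * M / r) * L) end;
  [field; repeat split; lra | rewrite H1; ring].
- match type of H2 with ?L = 0 =>
    transitivity (sin th * L) end;
  [field; repeat split; lra | rewrite H2; ring].
- match type of H3 with ?L = 0 =>
    transitivity L end;
  [field; repeat split; lra | rewrite H3; ring].
Qed.

(** * The tensor Z and its dual *)

Lemma star_antisym (M : R) (o : orientation) (T : tensor2) (D : R4 -> Prop) :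
  antisym_on D (star M o T).
Proof.
intros [[[t r] th] ph] _ a b; unfold star, sum4, vol, levi_civita.
destruct a, b; simpl; ring.
Qed.

Lemma Zten_antisym (M : R) (o : orientation) (F : tensor2) (D : R4 -> Prop) :
  antisym_on D (Zten M o F).
Proof. intros q _ a b; unfold Zten, asym2; ring. Qed.

Lemma starE (M t r th ph : R) (o : orientation) (T : tensor2) (a b : idx) :
  0 < M -> 2 * M < r -> 0 < sin th ->
  (forall a b, T (t, r, th, ph) a b = - T (t, r, th, ph) b a) ->
  let f := 1 - 2 * M / r in
  let g a b := T (t, r, th, ph) a b in
  star M o T (t, r, th, ph) a b = orient_sign o *
  match a, b with
  | i0, i1 => g i2 i3 / (r ^ 2 * sin th)
  | i0, i2 => - (f / sin th * g i1 i3)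
  | i0, i3 => f * sin th * g i1 i2
  | i1, i2 => - (g i0 i3 / (f * sin th))
  | i1, i3 => sin th / f * g i0 i2
  | i2, i3 => - (r ^ 2 * sin th * g i0 i1)
  | i1, i0 => - (g i2 i3 / (r ^ 2 * sin th))
  | i2, i0 => f / sin th * g i1 i3
  | i3, i0 => - (f * sin th * g i1 i2)
  | i2, i1 => g i0 i3 / (f * sin th)
  | i3, i1 => - (sin th / f * g i0 i2)
  | i3, i2 => r ^ 2 * sin th * g i0 i1
  | _, _ => 0
  end.
Proof.
intros HM Hr Hs Ta f g; subst f g; cbv beta.
assert (G10 := Ta i1 i0); assert (G20 := Ta i2 i0); assert (G30 := Ta i3 i0).
assert (G21 := Ta i2 i1); assert (G31 := Ta i3 i1); assert (G32 := Ta i3 i2).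
unfold star, raise2, sum4, vol.
destruct a, b; unfold levi_civita; simpl;
  rewrite ?G10, ?G20, ?G30, ?G21, ?G31, ?G32; field; repeat split; lra.
Qed.

Lemma YE (t r th ph : R) (a b : idx) : Y (t, r, th, ph) a b =
  match a, b with
  | i2, i3 => - (r ^ 3 * sin th) | i3, i2 => r ^ 3 * sin th | _, _ => 0
  end.
Proof.
unfold Y, asym2; rewrite !dcoordE; destruct a, b; field.
Qed.

(** Only the four components mixing (t,r) with (theta,phi) survive.  The dual
    of F and the rotation of the sphere by Y combine so that Z_tI is a multiple
    of F_rI and Z_rI of F_tI. *)
Lemma ZtenE (M t r th ph : R) (o : orientation) (F : tensor2) (a b : idx) :
  0 < M -> 2 * M < r -> 0 < sin th ->
  (forall a b, F (t, r, th, ph) a b = - F (t, r, th, ph) b a) ->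
  let f := 1 - 2 * M / r in
  let g a b := F (t, r, th, ph) a b in
  Zten M o F (t, r, th, ph) a b = 2 / 3 * orient_sign o * r *
  match a, b with
  | i0, i2 => - (f * g i1 i2)
  | i0, i3 => - (f * g i1 i3)
  | i1, i2 => - (g i0 i2 / f)
  | i1, i3 => - (g i0 i3 / f)
  | i2, i0 => f * g i1 i2
  | i3, i0 => f * g i1 i3
  | i2, i1 => g i0 i2 / f
  | i3, i1 => g i0 i3 / f
  | _, _ => 0
  end.
Proof.
intros HM Hr Hs Fa f g; subst f g; cbv beta.
unfold Zten, asym2, sum4; rewrite !YE.
rewrite !starE by assumption.
destruct a, b; simpl; field; repeat split; lra.
Qed.

(** Here F enters through two duals, so the sign of the orientation cancels. *)
Lemma star_ZtenE (M t r th ph : R) (o : orientation) (F : tensor2)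
    (a b : idx) :
  0 < M -> 2 * M < r -> 0 < sin th ->
  (forall a b, F (t, r, th, ph) a b = - F (t, r, th, ph) b a) ->
  let g a b := F (t, r, th, ph) a b in
  star M o (Zten M o F) (t, r, th, ph) a b = 2 / 3 * r *
  match a, b with
  | i0, i2 => g i0 i3 / sin th
  | i0, i3 => - (sin th * g i0 i2)
  | i1, i2 => g i1 i3 / sin th
  | i1, i3 => - (sin th * g i1 i2)
  | i2, i0 => - (g i0 i3 / sin th)
  | i3, i0 => sin th * g i0 i2
  | i2, i1 => - (g i1 i3 / sin th)
  | i3, i1 => sin th * g i1 i2
  | _, _ => 0
  end.
Proof.
intros HM Hr Hs Fa g; subst g; cbv beta.
rewrite starE; auto;
  [|intros c d; apply (Zten_antisym M o F (fun _ => True)); exact I].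
rewrite !ZtenE by assumption.
assert (He : orient_sign o * orient_sign o = 1) by (destruct o; simpl; ring).
destruct a, b; field_simplify_eq; try (repeat split; lra); try ring [He].
Qed.

Lemma Zten_Ck (M : R) (o : orientation) (F : tensor2) (n : nat) (a b : idx) :
  0 < M -> antisym_on (chart_dom M) F ->
  (forall a b, Ck n (chart_dom M) (fun q => F q a b)) ->
  Ck n (chart_dom M) (fun q => Zten M o F q a b) /\
  Ck n (chart_dom M) (fun q => star M o (Zten M o F) q a b).
Proof.
intros HM HF HC; assert (HD := open_chart_dom M).
assert (Hne := fun q => chart_dom_neq M q HM).
split.
- apply (Ck_ext _ HD n (fun q => 2 / 3 * orient_sign o * coord i1 q *
  match a, b with
  | i0, i2 => (-1) * (1 + -2 * M * / coord i1 q) * F q i1 i2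
  | i0, i3 => (-1) * (1 + -2 * M * / coord i1 q) * F q i1 i3
  | i1, i2 => (-1) * / (1 + -2 * M * / coord i1 q) * F q i0 i2
  | i1, i3 => (-1) * / (1 + -2 * M * / coord i1 q) * F q i0 i3
  | i2, i0 => (1 + -2 * M * / coord i1 q) * F q i1 i2
  | i3, i0 => (1 + -2 * M * / coord i1 q) * F q i1 i3
  | i2, i1 => / (1 + -2 * M * / coord i1 q) * F q i0 i2
  | i3, i1 => / (1 + -2 * M * / coord i1 q) * F q i0 i3
  | _, _ => 0
  end)).
  + intros [[[t r] th] ph] Hq.
    destruct (chart_dom_pos _ _ _ _ _ HM Hq) as (Hr' & Hs').
    rewrite ZtenE by (auto; apply HF; auto).
    destruct a, b; simpl; field; repeat split; lra.
  + destruct a, b; solve_Ck HD; first [apply HC | apply Hne].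
- apply (Ck_ext _ HD n (fun q => 2 / 3 * coord i1 q *
  match a, b with
  | i0, i2 => / sin (coord i2 q) * F q i0 i3
  | i0, i3 => (-1) * sin (coord i2 q) * F q i0 i2
  | i1, i2 => / sin (coord i2 q) * F q i1 i3
  | i1, i3 => (-1) * sin (coord i2 q) * F q i1 i2
  | i2, i0 => (-1) * / sin (coord i2 q) * F q i0 i3
  | i3, i0 => sin (coord i2 q) * F q i0 i2
  | i2, i1 => (-1) * / sin (coord i2 q) * F q i1 i3
  | i3, i1 => sin (coord i2 q) * F q i1 i2
  | _, _ => 0
  end)).
  + intros [[[t r] th] ph] Hq.
    destruct (chart_dom_pos _ _ _ _ _ HM Hq) as (Hr' & Hs').
    rewrite star_ZtenE by (auto; apply HF; auto).
    destruct a, b; simpl; field; repeat split; lra.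
  + destruct a, b; solve_Ck HD; first [apply HC | apply Hne].
Qed.

(** * The one-form beta as a gradient *)

(** r^2 F_tr, which is constant for the Coulomb field. *)
Definition electric_scalar (F : tensor2) (q : R4) : R :=
  coord i1 q * coord i1 q * F q i0 i1.

(** F_{theta phi} / sin theta, which is constant for the monopole field; it
    is r^2 times the radial magnetic field. *)
Definition magnetic_scalar (F : tensor2) (q : R4) : R :=
  / sin (coord i2 q) * F q i2 i3.

Lemma pd_electric_scalar (t r th ph : R) (F : tensor2) (a : idx) :
  ex_pd a (fun q => F q i0 i1) (t, r, th, ph) ->
  pd a (electric_scalar F) (t, r, th, ph) =
  r ^ 2 * pd a (fun q => F q i0 i1) (t, r, th, ph)
  + match a with i1 => 2 * r * F (t, r, th, ph) i0 i1 | _ => 0 end.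
Proof.
intros H; unfold electric_scalar; rewrite pd_mult; auto.
- replace (pd a (fun q => coord i1 q * coord i1 q) (t, r, th, ph))
    with (match a with i1 => 2 * r | _ => 0 end);
    [destruct a; simpl; ring|].
  symmetry; unfold pd; destruct a; simpl; apply is_derive_unique; auto_derive;
    auto; ring.
- unfold ex_pd; destruct a; simpl; auto_derive; auto.
Qed.

Lemma pd_magnetic_scalar (t r th ph : R) (F : tensor2) (a : idx) :
  0 < sin th -> ex_pd a (fun q => F q i2 i3) (t, r, th, ph) ->
  pd a (magnetic_scalar F) (t, r, th, ph) =
  pd a (fun q => F q i2 i3) (t, r, th, ph) / sin th
  - match a with
    | i2 => cos th / sin th ^ 2 * F (t, r, th, ph) i2 i3 | _ => 0 end.
Proof.
intros Hs H; unfold magnetic_scalar; rewrite pd_mult; auto.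
- replace (pd a (fun q => / sin (coord i2 q)) (t, r, th, ph))
    with (match a with i2 => - cos th / sin th ^ 2 | _ => 0 end);
    [destruct a; simpl; field; lra|].
  symmetry; unfold pd; destruct a; simpl; apply is_derive_unique; auto_derive;
    auto; try lra; field; lra.
- unfold ex_pd; destruct a; simpl; auto_derive; auto; lra.
Qed.

Lemma pd_weight_Zten (M t r th ph : R) (o : orientation) (F : tensor2)
    (a b : idx) : 0 < M -> chart_dom M (t, r, th, ph) ->
  antisym_on (chart_dom M) F ->
  (forall c a b, ex_pd c (fun q => F q a b) (t, r, th, ph)) ->
  let d c a b := pd c (fun q => F q a b) (t, r, th, ph) in
  let g a b := F (t, r, th, ph) a b in
  pd b (fun q => weight M a b q * Zten M o F q a b) (t, r, th, ph) =
  2 / 3 * orient_sign o *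
  match a, b with
  | i0, i2 => sin th * d i2 i1 i2 + cos th * g i1 i2
  | i0, i3 => d i3 i1 i3 / sin th
  | i1, i2 => - (sin th * d i2 i0 i2 + cos th * g i0 i2)
  | i1, i3 => - (d i3 i0 i3 / sin th)
  | i2, i0 => - (sin th * d i0 i1 i2)
  | i3, i0 => - (d i0 i1 i3 / sin th)
  | i2, i1 => sin th * d i1 i0 i2
  | i3, i1 => d i1 i0 i3 / sin th
  | _, _ => 0
  end.
Proof.
intros HM Hp HF Hex d g; subst d g; cbv beta.
destruct (chart_dom_pos _ _ _ _ _ HM Hp) as (Hr & Hs).
(* On the chart, weight times Z is an explicit function of theta times one
   component of F: the factors of r and f cancel. *)
pose (J q := 2 / 3 * orient_sign o *
  (match a, b with
  | i0, i2 | i2, i1 => sin (coord i2 q)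
  | i1, i2 | i2, i0 => - sin (coord i2 q)
  | i0, i3 | i3, i1 => / sin (coord i2 q)
  | i1, i3 | i3, i0 => - / sin (coord i2 q)
  | _, _ => 0
  end * match a, b with
  | i0, i2 | i2, i0 => F q i1 i2
  | i0, i3 | i3, i0 => F q i1 i3
  | i1, i2 | i2, i1 => F q i0 i2
  | i1, i3 | i3, i1 => F q i0 i3
  | _, _ => 0
  end)).
rewrite (pd_ext _ (open_chart_dom M) _ J); auto.
- unfold J; rewrite pd_scal, pd_mult.
  + f_equal; unfold pd at 1; destruct a, b; simpl;
      match goal with |- Derive ?f ?x * _ + _ = _ =>
        let l := fresh in evar (l : R);
        replace (Derive f x) with l;
        [ | symmetry; apply is_derive_unique; unfold l; auto_derive;
            [ auto; lra | reflexivity ] ] ; unfold l end;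
      field; lra.
  + unfold ex_pd; destruct a, b; simpl; auto_derive; auto; lra.
  + destruct a, b; cbv iota; lazymatch goal with
      | |- ex_pd _ (fun _ => 0) _ => apply ex_pd_const
      | |- _ => apply Hex end.
- intros [[[t' r'] th'] ph'] Hq.
  destruct (chart_dom_pos _ _ _ _ _ HM Hq) as (Hr' & Hs').
  rewrite ZtenE by (auto; apply HF; auto).
  unfold J, weight; destruct a, b; simpl; field; repeat split; lra.
Qed.

Lemma pd_weight_star_Zten (M t r th ph : R) (o : orientation) (F : tensor2)
    (a b : idx) : 0 < M -> chart_dom M (t, r, th, ph) ->
  antisym_on (chart_dom M) F ->
  (forall c a b, ex_pd c (fun q => F q a b) (t, r, th, ph)) ->
  let f := 1 - 2 * M / r in
  let d c a b := pd c (fun q => F q a b) (t, r, th, ph) in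
  let g a b := F (t, r, th, ph) a b in
  pd b (fun q => weight M a b q * star M o (Zten M o F) q a b) (t, r, th, ph) =
  2 / 3 *
  match a, b with
  | i0, i2 => - (d i2 i0 i3 / f)
  | i0, i3 => d i3 i0 i2 / f
  | i1, i2 => f * d i2 i1 i3
  | i1, i3 => - (f * d i3 i1 i2)
  | i2, i0 => d i0 i0 i3 / f
  | i3, i0 => - (d i0 i0 i2 / f)
  | i2, i1 => - (f * d i1 i1 i3 + 2 * M / r ^ 2 * g i1 i3)
  | i3, i1 => f * d i1 i1 i2 + 2 * M / r ^ 2 * g i1 i2
  | _, _ => 0
  end.
Proof.
intros HM Hp HF Hex f d g; subst f d g; cbv beta.
destruct (chart_dom_pos _ _ _ _ _ HM Hp) as (Hr & Hs).
assert (Hf := lapse_neq M r HM Hr).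
(* On the chart, weight times *Z is a power of f, up to sign, times one
   component of F. *)
pose (J q := 2 / 3 *
  (match a, b with
  | i0, i2 | i3, i0 => - / (1 - 2 * M / coord i1 q)
  | i0, i3 | i2, i0 => / (1 - 2 * M / coord i1 q)
  | i1, i2 | i3, i1 => 1 - 2 * M / coord i1 q
  | i1, i3 | i2, i1 => - (1 - 2 * M / coord i1 q)
  | _, _ => 0
  end * match a, b with
  | i0, i2 | i2, i0 => F q i0 i3
  | i0, i3 | i3, i0 => F q i0 i2
  | i1, i2 | i2, i1 => F q i1 i3
  | i1, i3 | i3, i1 => F q i1 i2
  | _, _ => 0
  end)).
rewrite (pd_ext _ (open_chart_dom M) _ J); auto.
- unfold J; rewrite pd_scal, pd_mult.
  + f_equal; unfold pd at 1; destruct a, b; simpl;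
      match goal with |- Derive ?f ?x * _ + _ = _ =>
        let l := fresh in evar (l : R);
        replace (Derive f x) with l;
        [ | symmetry; apply is_derive_unique; unfold l; auto_derive;
            [ repeat split; auto; lra | reflexivity ] ] ; unfold l end;
      field; repeat split; lra.
  + unfold ex_pd; destruct a, b; simpl; auto_derive; repeat split; auto; lra.
  + destruct a, b; cbv iota; lazymatch goal with
      | |- ex_pd _ (fun _ => 0) _ => apply ex_pd_const
      | |- _ => apply Hex end.
- intros [[[t' r'] th'] ph'] Hq.
  destruct (chart_dom_pos _ _ _ _ _ HM Hq) as (Hr' & Hs').
  rewrite star_ZtenE by (auto; apply HF; auto).
  unfold J, weight; destruct a, b; simpl; field; repeat split; lra.
Qed.

Lemma solve_linear (k x y : R) : k <> 0 -> k * x + y = 0 -> x = - y / k.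
Proof.
intros Hk H; apply (Rmult_eq_reg_l k); auto.
replace (k * (- y / k)) with (- y) by (field; auto); lra.
Qed.

(** All eight Maxwell equations are used, one for each derivative of F_tr and
    of F_{theta phi}: for Z the divergence equations b = t, r and the Bianchi
    identities containing F_tr, for *Z the remaining four. *)
Lemma weighted_div_Zten (M : R) (o : orientation) (F : tensor2) (p : R4)
    (a : idx) : 0 < M -> chart_dom M p -> antisym_on (chart_dom M) F ->
  (forall a b, Ck 1 (chart_dom M) (fun q => F q a b)) -> maxwell_chart M F ->
  weighted_div M (Zten M o F) p a =
    - (2 / 3) * orient_sign o / coord i1 p * pd a (electric_scalar F) p /\
  weighted_div M (star M o (Zten M o F)) p a =
    - (2 / 3) / coord i1 p * pd a (magnetic_scalar F) p.
Proof.
intros HM Hp HF HC HX.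
assert (Hex : forall c a b, ex_pd c (fun q => F q a b) p).
{ intros c d e; exact (proj1 (proj2 (HC d e)) c p Hp). }
assert (HZ := fun d e => Zten_Ck M o F 1 d e HM HF HC).
rewrite !weighted_divE; auto;
  [ | apply star_antisym
    | intros c d e; exact (proj1 (proj2 (proj2 (HZ d e))) c p Hp)
    | apply Zten_antisym
    | intros c d e; exact (proj1 (proj2 (proj1 (HZ d e))) c p Hp) ].
assert (B012 := maxwell_bianchi M F p i0 i1 i2 HM Hp HF HX).
assert (B013 := maxwell_bianchi M F p i0 i1 i3 HM Hp HF HX).
assert (B023 := maxwell_bianchi M F p i0 i2 i3 HM Hp HF HX).
assert (B123 := maxwell_bianchi M F p i1 i2 i3 HM Hp HF HX).
assert (A := fun c a b => pd_antisym _ (open_chart_dom M) F p c a b HF Hp).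
rewrite (A i1 i2 i0) in B012; rewrite (A i1 i3 i0) in B013.
rewrite (A i2 i3 i0) in B023; rewrite (A i2 i3 i1) in B123.
destruct p as [[[t r] th] ph].
destruct (chart_dom_pos _ _ _ _ _ HM Hp) as (Hr & Hs).
destruct (maxwell_div M t r th ph F HM Hp HF HX) as (D0 & D1 & D2 & D3).
unfold sum4; rewrite !pd_weight_Zten, !pd_weight_star_Zten by assumption.
rewrite pd_electric_scalar, pd_magnetic_scalar by auto.
assert (Hr2 : 0 < r ^ 2) by (apply pow_lt; lra).
assert (Hs2 : 0 < sin th * r ^ 2) by (apply Rmult_lt_0_compat; auto).
(* Each equation is solved for the derivative of F_tr or F_{theta phi} that
   occurs in it. *)
assert (S00 : pd i0 (fun q => F q i0 i1) (t, r, th, ph) =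
  - ((1 - 2 * M / r) * (sin th * pd i2 (fun q => F q i1 i2) (t, r, th, ph)
     + cos th * F (t, r, th, ph) i1 i2
     + pd i3 (fun q => F q i1 i3) (t, r, th, ph) / sin th))
  / (sin th * r ^ 2)).
{ apply (solve_linear (sin th * r ^ 2));
    [apply Rgt_not_eq, Hs2 | rewrite <- D1; ring]. }
assert (S01 : pd i1 (fun q => F q i0 i1) (t, r, th, ph) =
  - ((sin th * pd i2 (fun q => F q i0 i2) (t, r, th, ph)
     + cos th * F (t, r, th, ph) i0 i2
     + pd i3 (fun q => F q i0 i3) (t, r, th, ph) / sin th) / (1 - 2 * M / r)
     + sin th * 2 * r * F (t, r, th, ph) i0 i1)
  / (sin th * r ^ 2)).
{ apply (solve_linear (sin th * r ^ 2));
    [apply Rgt_not_eq, Hs2 | rewrite <- D0; ring]. }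
assert (S13 : pd i3 (fun q => F q i2 i3) (t, r, th, ph) =
  - (sin th * pd i0 (fun q => F q i0 i2) (t, r, th, ph) / (1 - 2 * M / r)
     - sin th * ((1 - 2 * M / r) * pd i1 (fun q => F q i1 i2) (t, r, th, ph)
                 + 2 * M / r ^ 2 * F (t, r, th, ph) i1 i2))
  / / (r ^ 2 * sin th)).
{ apply (solve_linear (/ (r ^ 2 * sin th)));
    [apply Rinv_neq_0_compat; lra | rewrite <- D2; unfold Rdiv; ring]. }
assert (S12 : pd i2 (fun q => F q i2 i3) (t, r, th, ph) =
  - (- (pd i0 (fun q => F q i0 i3) (t, r, th, ph) / (1 - 2 * M / r))
     + ((1 - 2 * M / r) * pd i1 (fun q => F q i1 i3) (t, r, th, ph)
                 + 2 * M / r ^ 2 * F (t, r, th, ph) i1 i3)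
     - cos th / sin th * F (t, r, th, ph) i2 i3 / r ^ 2) / / r ^ 2).
{ apply (solve_linear (/ r ^ 2)); [apply Rinv_neq_0_compat; lra|].
  transitivity (- 0); [rewrite <- D3; unfold Rdiv; ring | ring]. }
assert (S02 : pd i2 (fun q => F q i0 i1) (t, r, th, ph) =
  pd i1 (fun q => F q i0 i2) (t, r, th, ph)
  - pd i0 (fun q => F q i1 i2) (t, r, th, ph)) by lra.
assert (S03 : pd i3 (fun q => F q i0 i1) (t, r, th, ph) =
  pd i1 (fun q => F q i0 i3) (t, r, th, ph)
  - pd i0 (fun q => F q i1 i3) (t, r, th, ph)) by lra.
assert (S10 : pd i0 (fun q => F q i2 i3) (t, r, th, ph) =
  pd i2 (fun q => F q i0 i3) (t, r, th, ph)
  - pd i3 (fun q => F q i0 i2) (t, r, th, ph)) by lra.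
assert (S11 : pd i1 (fun q => F q i2 i3) (t, r, th, ph) =
  pd i2 (fun q => F q i1 i3) (t, r, th, ph)
  - pd i3 (fun q => F q i1 i2) (t, r, th, ph)) by lra.
destruct a; simpl coord; simpl metric;
  rewrite ?S00, ?S01, ?S02, ?S03, ?S10, ?S11, ?S12, ?S13; split;
  field; repeat split; lra.
Qed.

(** A 1-form that is, up to constant factors, both r times the divergence of
    Z / r and the gradient of f divided by r satisfies the two hypotheses of
    [div2_stress]. *)
Lemma div2_stress_weighted_div (M : R) (Z : tensor2) (b : tensor1) (f : R4 -> R)
    (k l : R) (p : R4) (a : idx) : 0 < M ->
  chart_dom M p -> antisym_on (chart_dom M) Z ->
  (forall a c, Ck 2 (chart_dom M) (fun q => Z q a c)) ->
  Ck 2 (chart_dom M) f ->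
  (forall q c, b q c = k * weighted_div M Z q c) ->
  (forall q c, chart_dom M q -> b q c = l * (/ coord i1 q * pd c f q)) ->
  (forall c e, ex_pd c (fun q => b q e) p) /\
  div2 M (stress M b) p a = - U p a * sqnorm M b p.
Proof.
intros HM Hp HZ HCZ HCf Hbk Hbl; assert (HD := open_chart_dom M).
assert (Hex : forall c e, ex_pd c (fun q => b q e) p).
{ intros c e.
  assert (K : Ck 1 (chart_dom M) (fun q => b q e)).
  { apply (Ck_ext _ HD 1 (fun q => l * (/ coord i1 q * pd e f q))).
    - intros q Hq; symmetry; auto.
    - solve_Ck HD; [|apply HCf].
      intros q Hq; apply chart_dom_neq with M; auto. }
  exact (proj1 (proj2 K) c p Hp). }
split; [exact Hex|].
apply div2_stress; auto.
- assert (E : forall c e, pd c (fun q => coord i1 q * b q e) p =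
    l * pd c (pd e f) p).
  { intros c e; rewrite <- pd_scal; apply (pd_ext _ HD); auto.
    intros q Hq; rewrite Hbl by auto; field; apply chart_dom_neq with M; auto. }
  intros c e; rewrite !E, (pd_comm _ HD f c e p); auto.
- rewrite <- (Rmult_0_r k), <- (weighted_div_div M Z p HM Hp HZ HCZ).
  assert (E : forall c, pd c (fun q => coord i1 q ^ 2 * sin (coord i2 q) *
    inv_metric M q c c * (/ coord i1 q * b q c)) p = k *
    pd c (fun q => coord i1 q ^ 2 * sin (coord i2 q) *
    inv_metric M q c c * (/ coord i1 q * weighted_div M Z q c)) p).
  { intros c; rewrite <- pd_scal; apply (pd_ext _ HD); auto.
    intros q Hq; rewrite Hbk; ring. }
  unfold sum4; rewrite !E; ring.
Qed.

(** * Real and imaginary parts *)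

Lemma beta_parts (M : R) (o : orientation) (F : tensor2) (q : R4) (a : idx) :
  Re (beta M o F q a) = - / 2 * weighted_div M (Zten M o F) q a /\
  Im (beta M o F q a) = - / 2 * weighted_div M (star M o (Zten M o F)) q a.
Proof.
unfold beta, weighted_div; cbv zeta.
generalize (sum4 (fun b => raise1 M U q b * Zten M o F q a b))
  (sum4 (fun b => raise1 M U q b * star M o (Zten M o F) q a b))
  (div2 M (Zten M o F) q a) (div2 M (star M o (Zten M o F)) q a).
intros x y z w; split; simpl; field.
Qed.

Definition re1 (V : ctensor1) : tensor1 := fun q a => Re (V q a).
Definition im1 (V : ctensor1) : tensor1 := fun q a => Im (V q a).

Lemma beta_norm_parts (M : R) (o : orientation) (F : tensor2) (q : R4) :
  beta_norm M o F q =
  RtoC (sqnorm M (re1 (beta M o F)) q + sqnorm M (im1 (beta M o F)) q).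
Proof.
unfold beta_norm, sqnorm, re1, im1, sum4C, sum4.
destruct q as [[[t r] th] ph].
set (q := (t, r, th, ph)).
destruct (beta M o F q i0) as [x0 y0], (beta M o F q i1) as [x1 y1],
  (beta M o F q i2) as [x2 y2], (beta M o F q i3) as [x3 y3].
unfold q; simpl inv_metric.
apply injective_projections; simpl; ring.
Qed.

(** The imaginary part of beta_a conj(beta)_b is antisymmetric in a and b, and
    there is no cross term between Re beta and Im beta in the real part. *)
Lemma Hten_parts (M : R) (o : orientation) (F : tensor2) (q : R4) (a b : idx) :
  Hten M o F q a b =
  RtoC (stress M (re1 (beta M o F)) q a b + stress M (im1 (beta M o F)) q a b).
Proof.
unfold Hten, stress; cbv zeta; rewrite beta_norm_parts; unfold re1, im1.
destruct (beta M o F q a) as [x0 y0], (beta M o F q b) as [x1 y1].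
apply injective_projections; simpl; field.
Qed.

Lemma RtoC_mult_pair (x u v : R) : (RtoC x * (u, v))%C = (x * u, x * v).
Proof. apply injective_projections; simpl; ring. Qed.

Lemma div2C_parts (M : R) (T : ctensor2) (p : R4) (a : idx) :
  div2C M T p a = (div2 M (fun q b c => Re (T q b c)) p a,
                   div2 M (fun q b c => Im (T q b c)) p a).
Proof.
unfold div2C, nabla2C, sum4C; rewrite !RtoC_mult_pair; reflexivity.
Qed.

Lemma div2_ext (M : R) (S T : tensor2) (p : R4) (a : idx) :
  (forall q b c, S q b c = T q b c) -> div2 M S p a = div2 M T p a.
Proof.
intros H.
assert (E : forall c b d, pd c (fun q => S q b d) p = pd c (fun q => T q b d) p).
{ intros c b d; apply Derive_ext; intros x; apply H. }
unfold div2, nabla2, sum4; rewrite !E, !H; reflexivity.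
Qed.

Lemma div2_zero (M : R) (p : R4) (a : idx) : div2 M (fun _ _ _ => 0) p a = 0.
Proof. unfold div2, nabla2, sum4; rewrite !pd_const; ring. Qed.

Lemma div2_plus (M : R) (S T : tensor2) (p : R4) (a : idx) :
  (forall c b d, ex_pd c (fun q => S q b d) p) ->
  (forall c b d, ex_pd c (fun q => T q b d) p) ->
  div2 M (fun q b c => S q b c + T q b c) p a = div2 M S p a + div2 M T p a.
Proof.
intros HS HT; rewrite !div2_diag; unfold nabla2, sum4.
rewrite !pd_plus by auto; ring.
Qed.

Definition div1 (M : R) (V : tensor1) (p : R4) : R :=
  sum4 (fun a => inv_metric M p a a * nabla1 M V p a a).

Lemma div1C_parts (M : R) (V : ctensor1) (p : R4) :
  div1C M V p = (div1 M (re1 V) p, div1 M (im1 V) p).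
Proof.
unfold div1C, nabla1C, sum4C; rewrite !RtoC_mult_pair.
fold (re1 V) (im1 V).
destruct p as [[[t r] th] ph]; unfold div1, sum4; simpl inv_metric.
apply injective_projections; simpl fst; simpl snd; ring.
Qed.

(** * The conserved current *)

(** The difference of the two sides is T^ab nabla_a xi_b, the contraction of a
    symmetric tensor with an antisymmetric one, as xi is a Killing field. *)
Lemma div1_killing (M : R) (T : tensor2) (V : tensor1) (p : R4) : 0 < M ->
  chart_dom M p -> (forall q a b, T q a b = T q b a) ->
  (forall q a, V q a = T q a i0) -> div1 M V p = div2 M T p i0.
Proof.
destruct p as [[[t r] th] ph]; intros HM Hp HT HV.
destruct (chart_dom_pos _ _ _ _ _ HM Hp) as (Hr & Hs).
rewrite div2_diag; unfold div1, nabla1, nabla2, sum4.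
assert (E : forall c a, pd c (fun q => V q a) (t, r, th, ph) =
  pd c (fun q => T q i0 a) (t, r, th, ph)).
{ intros c a; apply Derive_ext; intros x; rewrite HV; apply HT. }
rewrite !E, !HV, !christoffelE by assumption.
rewrite (HT _ i1 i0), (HT _ i2 i0), (HT _ i3 i0).
simpl inv_metric; field; repeat split; lra.
Qed.

(** With n = N^t and spatial parts measured by S = |b|^2 and V = |N|^2, the
    contraction is (n/2) (b_t^2 + f S) + b_t B, where B is the pairing of the
    spatial parts.  Cauchy-Schwarz and timelikeness give
    B^2 <= S V <= n^2 f S, so the discriminant of this quadratic form in b_t is
    not positive. *)
Lemma stress_positive (M : R) (b : tensor1) (p : R4) (N : idx -> R) : 0 < M ->
  chart_dom M p -> future_timelike M p N ->
  0 <= sum4 (fun a => stress M b p a i0 * N a).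
Proof.
destruct p as [[[t r] th] ph]; intros HM Hp [H1 H2].
destruct (chart_dom_pos _ _ _ _ _ HM Hp) as (Hr & Hs).
set (p := (t, r, th, ph)) in *.
unfold timelike, ip, sum4, xi in H1, H2; unfold stress, sqnorm, sum4.
unfold p in *; simpl metric in *; simpl inv_metric; fold p.
assert (Hf := lapse_pos M r HM Hr).
assert (Hr' : 0 < r) by lra.
clear HM Hp Hr; revert Hs Hf H1 H2.
generalize (b p i0) (b p i1) (b p i2) (b p i3) (N i0) (N i1) (N i2) (N i3)
  (1 - 2 * M / r) (sin th); intros b0 b1 b2 b3 n n1 n2 n3 f s Hs Hf H1 H2.
assert (Hn : 0 < n) by (apply (Rmult_lt_reg_l f); lra).
pose (S := f * b1 ^ 2 + b2 ^ 2 / r ^ 2 + b3 ^ 2 / (r ^ 2 * s ^ 2)).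
pose (V := n1 ^ 2 / f + r ^ 2 * n2 ^ 2 + r ^ 2 * s ^ 2 * n3 ^ 2).
pose (B := b1 * n1 + b2 * n2 + b3 * n3).
assert (HS : 0 <= S).
{ unfold S, Rdiv; assert (A := pow2_ge_0 b1); assert (A2 := pow2_ge_0 b2).
  assert (A3 := pow2_ge_0 b3).
  assert (0 < / r ^ 2) by (apply Rinv_0_lt_compat, pow_lt; lra).
  assert (0 < / (r ^ 2 * s ^ 2)).
  { apply Rinv_0_lt_compat, Rmult_lt_0_compat; apply pow_lt; lra. }
  repeat apply Rplus_le_le_0_compat; apply Rmult_le_pos; lra. }
assert (HV : V < f * n ^ 2).
{ match type of H1 with 0 < ?L => replace L with (f * n ^ 2 - V) in H1 end;
    [lra | unfold V; field; lra]. }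
(* Lagrange's identity exhibits S V - B^2 as a sum of squares. *)
assert (HB : B ^ 2 <= S * V).
{ assert (E : S * V - B ^ 2 = f * r ^ 2 * (b1 * n2 - b2 * n1 / (f * r ^ 2)) ^ 2
    + f * r ^ 2 * s ^ 2 * (b1 * n3 - b3 * n1 / (f * r ^ 2 * s ^ 2)) ^ 2
    + s ^ 2 * (b2 * n3 - b3 * n2 / s ^ 2) ^ 2).
  { unfold S, V, B; field; repeat split; lra. }
  assert (0 <= S * V - B ^ 2); [rewrite E|lra].
  assert (A1 := pow2_ge_0 r); assert (A2 := pow2_ge_0 s).
  assert (A3 : 0 <= f * r ^ 2) by (apply Rmult_le_pos; lra).
  assert (A4 : 0 <= f * r ^ 2 * s ^ 2) by (apply Rmult_le_pos; lra).
  apply Rplus_le_le_0_compat; [apply Rplus_le_le_0_compat|];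
    (apply Rmult_le_pos; [lra | apply pow2_ge_0]). }
assert (HQ : B ^ 2 <= n ^ 2 * (f * S)).
{ apply Rle_trans with (S * V); auto.
  replace (n ^ 2 * (f * S)) with (S * (f * n ^ 2)) by ring.
  apply Rmult_le_compat_l; lra. }
apply (Rmult_le_reg_l (2 * n)); [lra|].
match goal with |- _ <= _ * ?e =>
  replace (2 * n * e) with ((n * b0 + B) ^ 2 + (n ^ 2 * (f * S) - B ^ 2)) end.
- assert (A := pow2_ge_0 (n * b0 + B)); lra.
- unfold S, B; field; repeat split; lra.
Qed.

(** * Maxwell fields on the exterior *)

Lemma pullback_antisym (M : R) (F : tensor2) (k : axis) : 0 < M ->
  two_form M F -> antisym_on (chart_dom M) (pullback k F).
Proof.
intros HM HF q Hq a b.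
assert (E : exterior M (chart k q)) by (apply chart_cover; eauto).
assert (A := HF _ E); unfold pullback, sum4.
rewrite (A i0 i0), (A i1 i1), (A i2 i2), (A i3 i3), (A i1 i0), (A i2 i0),
  (A i3 i0), (A i2 i1), (A i3 i1), (A i3 i2).
assert (D : forall i, F (chart k q) i i = 0).
{ intros i; assert (K := A i i); lra. }
rewrite !D; ring.
Qed.

Lemma sum4C_RtoC (f : idx -> R) (h : idx -> C) :
  (forall a, h a = RtoC (f a)) -> sum4C h = RtoC (sum4 f).
Proof.
intros H; unfold sum4C, sum4; rewrite !H, !RtoC_plus; reflexivity.
Qed.

Theorem lemma11 (M : R) (HM : 0 < M) (o : orientation) (F : tensor2)
    (HF : maxwell_field M F) (k : axis) (p : R4) (Hp : chart_dom M p) :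
  let Fk := pullback k F in
  let H := Hten M o Fk in
  (forall a : idx,
     div2C M H p a = (- RtoC (U p a) * beta_norm M o Fk p)%C) /\
  sum4C (fun a => RtoC (xi a) * div2C M H p a)%C = RtoC 0 /\
  div1C M (current M o Fk) p = RtoC 0 /\
  (forall N : idx -> R, future_timelike M p N ->
     let e := sum4C (fun a => current M o Fk p a * RtoC (N a))%C in
     Im e = 0 /\ 0 <= Re e).
Proof.
intros Fk H; destruct HF as (HF1 & HF2 & HF3).
assert (HD := open_chart_dom M).
assert (HA : antisym_on (chart_dom M) Fk) by (apply pullback_antisym; auto).
assert (HC : forall n a b, Ck n (chart_dom M) (fun q => Fk q a b)).
{ intros n a b; apply smooth_on_Ck, HF2. }
assert (HX : maxwell_chart M Fk) by apply HF3.
assert (HZ := fun a b => Zten_Ck M o Fk 2 a b HM HA (HC 2%nat)).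
assert (Hne := fun q => chart_dom_neq M q HM).
set (rb := re1 (beta M o Fk)); set (ib := im1 (beta M o Fk)).
assert (K1 : forall a, (forall c e, ex_pd c (fun q => rb q e) p) /\
  div2 M (stress M rb) p a = - U p a * sqnorm M rb p).
{ intros a; apply (div2_stress_weighted_div M (Zten M o Fk) rb
    (electric_scalar Fk) (- / 2) (/ 3 * orient_sign o) p a HM Hp).
  - apply Zten_antisym.
  - intros c d; exact (proj1 (HZ c d)).
  - unfold electric_scalar; solve_Ck HD; apply HC.
  - intros q c; apply beta_parts.
  - intros q c Hq; unfold rb, re1; rewrite (proj1 (beta_parts M o Fk q c)).
    rewrite (proj1 (weighted_div_Zten M o Fk q c HM Hq HA (HC 1%nat) HX)).
    field; apply (Hne q Hq). }
assert (K2 : forall a, (forall c e, ex_pd c (fun q => ib q e) p) /\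
  div2 M (stress M ib) p a = - U p a * sqnorm M ib p).
{ intros a; apply (div2_stress_weighted_div M (star M o (Zten M o Fk)) ib
    (magnetic_scalar Fk) (- / 2) (/ 3) p a HM Hp).
  - apply star_antisym.
  - intros c d; exact (proj2 (HZ c d)).
  - unfold magnetic_scalar; solve_Ck HD; [apply Hne | apply HC].
  - intros q c; apply beta_parts.
  - intros q c Hq; unfold ib, im1; rewrite (proj2 (beta_parts M o Fk q c)).
    rewrite (proj2 (weighted_div_Zten M o Fk q c HM Hq HA (HC 1%nat) HX)).
    field; apply (Hne q Hq). }
assert (X1 := proj1 (K1 i0)); assert (X2 := proj1 (K2 i0)).
set (T q a b := stress M rb q a b + stress M ib q a b).
assert (HT : forall q a b, H q a b = RtoC (T q a b)).
{ intros; apply Hten_parts. }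
assert (KT : forall a, div2 M T p a = - U p a * (sqnorm M rb p + sqnorm M ib p)).
{ intros a; unfold T; rewrite div2_plus, (proj2 (K1 a)), (proj2 (K2 a)); [ring| |];
    intros c d e; apply pd_stress; auto. }
assert (Kre : forall a, div2C M H p a = RtoC (div2 M T p a)).
{ intros a; rewrite div2C_parts.
  rewrite (div2_ext M (fun q b c => Re (H q b c)) T),
    (div2_ext M (fun q b c => Im (H q b c)) (fun _ _ _ => 0)), div2_zero;
    [reflexivity | |]; intros q b c; rewrite HT; reflexivity. }
assert (HJ : forall q a, current M o Fk q a = RtoC (T q a i0)).
{ intros q a; unfold current; fold H.
  rewrite (sum4C_RtoC (fun b => T q a b * xi b)).
  - unfold sum4, xi; f_equal; ring.
  - intros b; rewrite HT, RtoC_mult; reflexivity. }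
assert (K0 : div2 M T p i0 = 0).
{ rewrite KT; unfold U; rewrite dcoordE; ring. }
split; [|split; [|split]].
- intros a; rewrite Kre, KT, beta_norm_parts, RtoC_mult, RtoC_opp; reflexivity.
- rewrite (sum4C_RtoC (fun a => xi a * div2 M T p a)).
  + unfold sum4, xi; rewrite K0; f_equal; ring.
  + intros a; rewrite Kre, RtoC_mult; reflexivity.
- rewrite div1C_parts, (div1_killing M T), K0; auto.
  + rewrite (div1_killing M (fun _ _ _ => 0)), div2_zero; auto.
    intros q a; unfold im1; rewrite HJ; reflexivity.
  + intros q a b; unfold T, stress.
    assert (G : metric M q a b = metric M q b a).
    { destruct q as [[[t r] th] ph], a, b; reflexivity. }
    rewrite G; ring.
  + intros q a; unfold re1; rewrite HJ; reflexivity.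
- intros N HN; cbv zeta.
  rewrite (sum4C_RtoC (fun a => T p a i0 * N a));
    [|intros a; rewrite HJ, RtoC_mult; reflexivity].
  split; [reflexivity|]; simpl.
  assert (P1 := stress_positive M rb p N HM Hp HN).
  assert (P2 := stress_positive M ib p N HM Hp HN).
  unfold sum4, T in *; lra.
Qed.
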